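(* Let $G$ be a (finite, simple) plane graph with minimum degree five having no vertices of degree from $7$ to $11$. Then $G$ contains at least one of the following minor $5$-stars: a $\langle 5,6,6,5,\infty\rangle$-star, a $\langle 5,6,6,6,17\rangle$-star, a $\langle 6,6,6,6,6\rangle$-star.
   Context: A plane graph is a graph embedded in the plane without edge crossings; $\deg(v)$ denotes the degree of $v$ in $G$. For integers (or $\infty$) $\kappa_1,\dots,\kappa_5$, a $\langle \kappa_1,\kappa_2,\kappa_3,\kappa_4,\kappa_5\rangle$-star in $G$ is a vertex $v$ of degree exactly $5$ together with its five neighbors $v_1,\dots,v_5$, listed in the cyclic order around $v$ given by the embedding (starting at some neighbor, in either orientation), such that $\deg(v_i)\le \kappa_i$ for $i=1,\dots,5$; the entry $\infty$ means no restriction. A minor $5$-star is a $5$-vertex together with its five neighbors. *)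

(* Defs.v *)
From mathcomp Require Import all_boot all_order all_algebra.
From mathcomp Require Import all_classical all_reals all_analysis.

Set Implicit Arguments.
Unset Strict Implicit.
Unset Printing Implicit Defensive.

Import Order.TTheory GRing.Theory Num.Theory.
Import numFieldNormedType.Exports.
Local Open Scope classical_set_scope.
Local Open Scope ring_scope.

Record sgraph := SGraph {
  vertex :> finType;
  adj : rel vertex;
  adj_sym : symmetric adj;
  adj_irrefl : irreflexive adj
}.

Definition neighbors (G : sgraph) (v : G) : {set G} := [set w | adj v w]%SET.

Definition deg (G : sgraph) (v : G) : nat := #|neighbors v|.

Definition min_degree_is (G : sgraph) (d : nat) : Prop :=
  (forall v : G, (d <= deg v)%N) /\ (exists v : G, deg v = d).

(* The library norm on R * R is the sup norm; circles below are Euclidean. *)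
Definition eucl_dist (R : realType) (p q : R * R) : R :=
  Num.sqrt ((p.1 - q.1) ^+ 2 + (p.2 - q.2) ^+ 2).

(* The edge {u, v} is drawn as a Jordan arc, parametrized by [0, 1] from u to v
   as [edge_arc u v] and in the opposite direction as [edge_arc v u].  The values of
   [edge_arc u v] outside [0, 1], or for non-adjacent u and v, are irrelevant. *)
Record plane_graph (R : realType) := PlaneGraph {
  graph :> sgraph;
  pos : graph -> R * R;
  edge_arc : graph -> graph -> R -> R * R;
  pos_inj : injective pos;
  arc_continuous : forall u v, adj u v ->
    {within `[0, 1], continuous (edge_arc u v)};
  arc_inj : forall u v, adj u v -> {in `[0, 1] &, injective (edge_arc u v)};
  arc_start : forall u v, adj u v -> edge_arc u v 0 = pos u;
  arc_rev : forall u v, adj u v ->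
    {in `[0, 1], forall t, edge_arc v u t = edge_arc u v (1 - t)};
  arc_avoids_vertices : forall u v w, adj u v ->
    {in `]0, 1[, forall t, edge_arc u v t <> pos w};
  arcs_do_not_cross : forall u v x y, adj u v -> adj x y ->
    [set u; v]%SET != [set x; y]%SET ->
    {in `]0, 1[ &, forall s t, edge_arc u v s <> edge_arc x y t}
}.

(* q is the last point of the edge vw, traversed from v, on the circle of radius
   r around v.  Since the edge stays outside the disc after q, replacing its
   part before q by the radius from v to q (for all edges at v, with r small)
   gives a drawing in which the edges leave v along straight segments. *)
Definition last_exit (R : realType) (G : plane_graph R) (v w : G) (r : R)
    (q : R * R) : Prop :=
  exists t : R, [/\ t \in `[0, 1], edge_arc v w t = q, eucl_dist q (pos v) = r &
    {in `]t, 1], forall s, r < eucl_dist (edge_arc v w s) (pos v)}].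

(* The cyclic order of the edges at v is the angular order of their last exit
   points from small discs around v; it does not depend on the radius once the
   radius is small enough. *)
Definition counterclockwise (R : realType) (G : plane_graph R) (v : G) (k : nat)
    (n : 'I_k -> G) : Prop :=
  \forall r \near (0 : R)^'+, exists theta : 'I_k -> R,
    [/\ forall i j : 'I_k, (i < j)%N -> theta i < theta j,
        forall i j : 'I_k, theta j < theta i + 2 * pi &
        forall i : 'I_k, last_exit v (n i) r
          ((pos v).1 + r * cos (theta i), (pos v).2 + r * sin (theta i))].

Definition cyclic_listing (R : realType) (G : plane_graph R) (v : G) (k : nat)
    (n : 'I_k -> G) : Prop :=
  [/\ injective n, [set n i | i : 'I_k]%SET = neighbors v &
      counterclockwise v n \/ counterclockwise v (n \o @rev_ord k)].

(* [None] stands for the entry infinity. *)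
Definition bounded_by (d : nat) (kappa : option nat) : bool :=
  if kappa is Some k then (d <= k)%N else true.

Definition has_star (R : realType) (G : plane_graph R)
    (kappa : 5.-tuple (option nat)) : Prop :=
  exists (v : G) (n : 'I_5 -> G),
    [/\ deg v = 5%N, cyclic_listing v n &
        forall i : 'I_5, bounded_by (deg (n i)) (tnth kappa i)].

(* Main.v *)
Require Import Defs.
From mathcomp Require Import all_boot all_order all_algebra.
From mathcomp Require Import fingroup perm.
From mathcomp Require Import all_classical all_reals all_analysis.
From mathcomp Require Import ring lra zify.

(* The angle through which an edge turns as seen from a point p, weighted by a
   circulation z and summed over all edges, is a locally constant function of p
   off the support of z.  Straighten every edge to a radius inside a small disc
   around each of its ends, and read this index in the corners between
   consecutive radii: it jumps by z across an edge, and going along an edge that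
   z does not use it does not change.  Hence along an edge x it changes by
   d(x) z(x) for some number d(x).  Multiplying by z and summing telescopes
   around the vertices, so the quadratic form d vanishes on circulations and d z
   is a coboundary for every circulation z; correcting the index by it gives a
   function on the faces of the rotation system whose jumps are z.  So the faces
   span the cycle space and E + 1 <= V + F, without the Jordan curve theorem.

   The rotation at a vertex does not depend on the radius r: for two disjoint
   arcs f, g crossing an annulus, a continuous angle of f(t) - g(s) stays within
   pi/2 of the angle of f(t) or of the opposite of g(s) on the sides of the
   square of parameters, which forces the same cyclic order at both ends.

   Discharging: a vertex w of degree d >= 12 gives 1 - 6/d >= 1/2 to each
   neighbor, a neighbor of degree 6 passes half of it to each of its two
   neighbors in the cyclic order at w, and a corner in a face which is not a
   triangle gives 1/2.  Every vertex of degree 5 then receives at least 1. *)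

Set Implicit Arguments.
Unset Strict Implicit.
Unset Printing Implicit Defensive.

Import Order.TTheory GRing.Theory Num.Theory.
Import numFieldNormedType.Exports.
Local Open Scope classical_set_scope.
Local Open Scope ring_scope.

(** * Angles and their continuous choice *)

Section Plane.
Variable R : realType.
Notation pt := (R * R)%type.
Implicit Types (x y : pt) (a b t : R).

(** The edges are merely continuous curves, so away from the vertices nothing is known about the
    plane beside an edge. It has the form d(x) z(x) because the index is linear in z and its change
    along x vanishes as soon as z(x) = 0. The drawing is therefore controlled only inside discs
    around the vertices, where the edges are radii, and along edges that carry no flow, where the
    edge itself serves as the path. The unknown numbers disappear by linear algebra: the quadratic
    form polarizes, so d z is orthogonal to every circulation, and the orthogonal complement of the
    cycle space consists of the coboundaries. *)

Definition dot x y : R := x.1 * y.1 + x.2 * y.2.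
Definition cross x y : R := x.1 * y.2 - x.2 * y.1.
Definition angle_of x a := exists2 rho : R, 0 < rho & x = (rho * cos a, rho * sin a).

Lemma cos_atan_gt0 t : 0 < cos (atan t :> R).
Proof. by apply: cos_gt0_pihalf; rewrite atan_gtNpi2 atan_ltpi2. Qed.

Lemma sin_atan t : sin (atan t :> R) = t * cos (atan t).
Proof.
have := atanK t; rewrite /tan => {2}<-.
by rewrite divfK // gt_eqF // cos_atan_gt0.
Qed.

(** The tangent of the turn from x to y is [cross x y / dot x y], and [atan] takes the right branch
    because a positive inner product keeps the turn below a right angle. *)
Lemma angle_of_step x y a : angle_of x a -> 0 < dot x y ->
  angle_of y (a + atan (cross x y / dot x y)).
Proof.
case: y => y1 y2 [rho rho0 ->]; rewrite /dot /cross /=; set d := (X in 0 < X) => d0.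
set t := _ / d; have c0 : cos (atan t) != 0 by rewrite gt_eqF // cos_atan_gt0.
have r0 : rho != 0 by rewrite gt_eqF.
have d0' := lt0r_neq0 d0; have e := cos2Dsin2 a.
exists (d / (rho * cos (atan t)));
    first by rewrite divr_gt0 // mulr_gt0 // cos_atan_gt0.
rewrite cosD sinD sin_atan; move: (cos (atan t)) c0 => C c0; rewrite {}/t.
move: d0'; rewrite /d => d0'.
congr pair; apply/eqP; rewrite eq_sym -subr_eq0; apply/eqP.
- transitivity (y1 * (cos a ^+ 2 + sin a ^+ 2 - 1)); last by rewrite e; ring.
  by field; rewrite r0 c0 d0'.
- transitivity (y2 * (cos a ^+ 2 + sin a ^+ 2 - 1)); last by rewrite e; ring.
  by field; rewrite r0 c0 d0'.
Qed.

Lemma dot_angle_of x y a b : angle_of x a -> angle_of y b ->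
  exists2 c : R, 0 < c & dot x y = c * cos (b - a).
Proof.
move=> [r r0 ->] [s s0 ->]; exists (r * s); first exact: mulr_gt0.
by rewrite /dot /= cosB; ring.
Qed.

Lemma cos_angle_of_gt0 x y a b : angle_of x a -> angle_of y b ->
  0 < dot x y -> 0 < cos (b - a).
Proof. by move=> xa yb; have [c c0 ->] := dot_angle_of xa yb; rewrite pmulr_rgt0. Qed.

Lemma angle_of_cos1 x a b : angle_of x a -> angle_of x b -> cos (b - a) = 1.
Proof.
move=> [r r0 ->] [s s0 [e1 e2]].
have ea := cos2Dsin2 a; have eb := cos2Dsin2 b.
have rs : r = s.
  have : r ^+ 2 = s ^+ 2.
    rewrite -[LHS]mulr1 -ea -[RHS]mulr1 -eb !mulrDr -!exprMn e1 e2 //.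
  by move/eqP; rewrite eqrXn2 // ?ltW // => /eqP.
move: e1 e2; rewrite rs => /(mulfI (lt0r_neq0 s0)) e1 /(mulfI (lt0r_neq0 s0)) e2.
by rewrite cosB -e1 -e2 -!expr2.
Qed.

Lemma cosD2pin a (m : int) : cos (a + m%:~R * (2 * pi)) = cos a.
Proof.
have P n c : cos (c + n%:R * (2 * pi) :> R) = cos c.
  by rewrite -[RHS](periodicn (@cosD2pi R) n c) !mulr_natl.
case: m => n; first exact: P.
rewrite -(P n.+1 (a + _)) NegzE; congr cos; rewrite mulrNz; ring.
Qed.

Lemma sinD2pin a (m : int) : sin (a + m%:~R * (2 * pi)) = sin a.
Proof. by rewrite -!cosBpihalf addrAC cosD2pin. Qed.

Lemma shift_2pi a b : exists m : int, a <= b + m%:~R * (2 * pi) < a + 2 * pi.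
Proof.
have p0 : 0 < 2 * pi :> R by rewrite mulr_gt0 // pi_gt0.
have p0' := lt0r_neq0 p0.
exists (- Num.floor ((b - a) / (2 * pi))).
have := floor_le ((b - a) / (2 * pi)); have := floorD1_gt ((b - a) / (2 * pi)).
rewrite intrD ltr_pdivrMr // ler_pdivlMr // => h1 h2.
by rewrite mulrNz mulNr; lra.
Qed.

Lemma cos_eq1_2pi a : cos a = 1 -> -(2 * pi) < a < 2 * pi -> a = 0.
Proof.
move=> c1 /andP[a1 a2].
wlog a0 : a c1 a1 a2 / 0 <= a => [H|].
  case: (leP 0 a) => h; first exact: H.
  by apply/eqP; rewrite -oppr_eq0; apply/eqP; apply: H; rewrite ?cosN //; lra.
have p0 := @pi_gt0 R.
have := sin_gt0_pi (x := a / 2).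
have -> : sin (a / 2) = 0.
  apply/eqP; rewrite -sqrf_eq0 sin2cos2.
  by apply/eqP; have := cos_mulr2n (a / 2); rewrite mulr2n -splitr c1; lra.
by case: (ltP 0 a) => h; [rewrite ltxx => /(_ _) H; suff: false by []; apply: H;
    lra | lra].
Qed.

Lemma cos_gt0_small a : 0 < cos a -> -(3 * pi / 2) < a < 3 * pi / 2 ->
  -(pi / 2) < a < pi / 2.
Proof.
move=> c0 /andP[a1 a2].
have p0 := @pi_gt0 R.
have H : forall b, b < 3 * pi / 2 -> 0 < cos b -> b < pi / 2.
  move=> b b2 cb; case: (ltP b (pi / 2)) => // h.
  have := @cos_ge0_pihalf R (b - pi); move: cb.
  by rewrite -{1}(subrK pi b) cosDpi => cb H; have := H; lra.
apply/andP; split; last exact: H.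
by rewrite ltrNl; apply: H; rewrite ?cosN //; lra.
Qed.

Lemma cos_eq1_int a : cos a = 1 -> exists m : int, a = m%:~R * (2 * pi).
Proof.
move=> c1; have [m /andP[h1 h2]] := shift_2pi 0 a; exists (- m).
have p0 := @pi_gt0 R.
suff : a + m%:~R * (2 * pi) = 0 by rewrite mulrNz; lra.
by apply: cos_eq1_2pi; rewrite ?cosD2pin //; apply/andP; split; lra.
Qed.

Lemma angle_ofD2pi x a (m : int) : angle_of x a -> angle_of x (a + m%:~R * (2 * pi)).
Proof. by move=> [r r0 ->]; exists r; rewrite // cosD2pin sinD2pin. Qed.

(** One of the four axis directions has a positive inner product with x, and [angle_of_step] leads
    from it to x. *)
Lemma angle_of_exists x : x <> 0 -> exists a, angle_of x a.
Proof.
move=> x0.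
have base d : angle_of (cos d, sin d) d by exists 1; rewrite ?mul1r.
case: (ltrgtP x.1 0) => h1.
- exists (pi + atan (cross (cos pi, sin pi) x / dot (cos pi, sin pi) x)).
  by apply: angle_of_step => //; rewrite /dot /= cospi sinpi; lra.
- exists (0 + atan (cross (cos 0, sin 0) x / dot (cos 0, sin 0) x)).
  by apply: angle_of_step => //; rewrite /dot /= cos0 sin0; lra.
case: (ltrgtP x.2 0) => h2.
- exists (-(pi/2) + atan (cross (cos (-(pi/2)), sin (-(pi/2))) x / dot (cos (-(pi/2)),
      sin (-(pi/2))) x)).
  by apply: angle_of_step => //; rewrite /dot /= cosN sinN cos_pihalf sin_pihalf; lra.
- exists (pi/2 + atan (cross (cos (pi/2), sin (pi/2)) x / dot (cos (pi/2),
      sin (pi/2)) x)).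
  by apply: angle_of_step => //; rewrite /dot /= cos_pihalf sin_pihalf; lra.
by case: x0; rewrite [x]surjective_pairing h1 h2.
Qed.

Lemma angle_of_in x b : x <> 0 -> exists2 a, angle_of x a & b <= a < b + 2 * pi.
Proof.
move=> /angle_of_exists[a xa]; have [m mb] := shift_2pi b a.
by exists (a + m%:~R * (2 * pi)) => //; exact: angle_ofD2pi.
Qed.

(** Composing with this retraction onto [0, 1] turns functions continuous on the interval into
    continuous functions on the whole line. *)
Definition clamp (t : R) : R := Order.max 0 (Order.min 1 t).

Lemma clamp_itv t : clamp t \in `[0, 1].
Proof. by rewrite in_itv /= /clamp; case: (ltP 1 t) => h; case: (ltP 0 _) => h';
    lra. Qed.

Lemma clampE t : t \in `[0, 1] -> clamp t = t.
Proof. by rewrite in_itv /= /clamp => /andP[h0 h1]; rewrite min_r // max_r. Qed.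

Lemma clampB (x y : R) : clamp (x - y) + y = Order.max y (Order.min x (y + 1)).
Proof.
rewrite /clamp minC.
case: (leP (x - y) 1) => h1; [rewrite (min_l (y := y + 1));
    last by lra|rewrite (min_r (y := y + 1)); last by lra].
  by case: (leP 0 (x - y)) => h2; [rewrite (max_r (x := y));
      lra|rewrite (max_l (x := y)); lra].
by rewrite max_r ?max_r //; lra.
Qed.

Lemma continuous_clamp : continuous clamp.
Proof.
move=> t; rewrite /clamp.
apply: (@continuous_max R R (fun=> 0) (fun t => Order.min 1 t));
    first exact: cst_continuous.
by apply: (@continuous_min R R (fun=> 1) id); [exact: cst_continuous|exact: cvg_id].
Qed.

Lemma continuous_clamp_comp (T : topologicalType) (f : R -> T) :
  {within `[0, 1], continuous f} -> continuous (f \o clamp).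
Proof.
move=> /subspace_continuousP cf t U.
move=> /(cf (clamp t) (clamp_itv t)); rewrite /= => h.
have := continuous_clamp h; rewrite /= /nbhs /=; apply: (@filterS _ (nbhs t)) => u;
    apply; exact: clamp_itv.
Qed.

(* The pairs of parameters whose images are d apart form a compact set that does
   not meet the diagonal. *)
Lemma unif_step (f : R -> pt) (d : R) : continuous f -> 0 < d ->
  exists N : nat, forall t t', t \in `[0, 1] -> t' \in `[0, 1] ->
    `|t - t'| <= N.+1%:R^-1 -> `|f t - f t'| < d.
Proof.
move=> cf d0.
pose K := [set u : R * R | u.1 \in `[0, 1] /\ u.2 \in `[0, 1] /\ d <= `|f u.1 - f u.2|].
have cK : compact K.
  have -> : K = (`[0, 1] `*` `[0, 1]) `&` [set u : R * R | d <= `|f u.1 - f u.2|].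
    by apply/seteqP; split=> u /=; [move=> [? []]|move=> [[]]].
  apply: compact_closedI; first by apply: compact_setX; exact: segment_compact.
  apply: (@closed_comp _ _ (fun u : R * R => `|f u.1 - f u.2|) [set x | d <= x]);
      last exact: closed_ge.
  move=> u _.
  apply: (@continuous_comp _ _ _ (fun u : R * R => f u.1 - f u.2) Num.norm);
      last exact: norm_continuous.
  by apply: continuousB; apply: continuous_comp;
      [exact: cvg_fst|exact: cf|exact: cvg_snd|exact: cf].
have [[u Ku]|K0] := pselect (K !=set0); last first.
  exists 0%N => t t' ht ht' _; rewrite ltNge; apply/negP => h; apply: K0.
  by exists (t, t').
have K1 : K !=set0 by exists u.
have [|c cK' cmin] := @compact_EVT_min _ R (fun u : R * R => `|u.1 - u.2|) K K1 cK.
  apply: continuous_subspaceT => v.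
  apply: (@continuous_comp _ _ _ (fun u : R * R => u.1 - u.2) Num.norm);
      last exact: norm_continuous.
  by apply: continuousB; [exact: cvg_fst|exact: cvg_snd].
have c0 : 0 < `|c.1 - c.2|.
  rewrite normr_gt0 subr_eq0; apply/eqP => e.
  by move: cK'; rewrite inE /K /= e subrr normr0 => -[_ [_]]; lra.
exists (Num.trunc (`|c.1 - c.2|^-1)) => t t' ht ht' htt.
rewrite ltNge; apply/negP => h.
have := cmin (t, t'); rewrite inE => /(_ _) H.
have {}H : `|c.1 - c.2| <= `|t - t'| by apply: H.
have := le_trans H htt; rewrite leNgt => /negP; apply.
by rewrite invf_plt ?posrE // truncnS_gt.
Qed.

Lemma curves_apart (f g : R -> pt) : continuous f -> continuous g ->
  (forall t s, t \in `[0, 1] -> s \in `[0, 1] -> f t <> g s) ->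
  exists2 d : R, 0 < d & forall t s, t \in `[0, 1] -> s \in `[0, 1] ->
      d <= `|f t - g s|.
Proof.
move=> cf cg fg.
have [|||c cK cmin] := @compact_EVT_min _ R (fun u : R * R =>
    `|f u.1 - g u.2|) (`[0, 1] `*` `[0, 1]).
- by exists (0, 0); split; rewrite /= in_itv /= lexx ler01.
- by apply: compact_setX; exact: segment_compact.
- apply: continuous_subspaceT => v.
  apply: (@continuous_comp _ _ _ (fun u : R * R => f u.1 - g u.2) Num.norm);
      last exact: norm_continuous.
  by apply: continuousB; apply: continuous_comp;
      [exact: cvg_fst|exact: cf|exact: cvg_snd|exact: cg].
move: cK; rewrite inE => -[/= c1 c2].
exists `|f c.1 - g c.2|; first by rewrite normr_gt0 subr_eq0; apply/eqP; exact: fg.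
by move=> t s ht hs; apply: (cmin (t, s)); rewrite inE.
Qed.

Lemma dot_close x y (d : R) : d <= `|x| -> `|x - y| < d / 2 -> 0 < dot x y.
Proof.
rewrite !prod_normE /= /dot; case: x => x1 x2; case: y => y1 y2 /=.
rewrite gt_max le_max => h /andP[]; rewrite !ltr_norml => /andP[h1 h2] /andP[h3 h4].
(* Here a is the coordinate that attains the sup norm of x. Then a b > d^2 / 2, while completing the
   square gives c e >= - (c - e)^2 / 4 > - d^2 / 16. *)
have H (a b c e : R) : d <= `|a| -> -(d/2) < a - b < d/2 -> -(d/2) < c - e < d/2 ->
    0 < a * b + c * e.
  move=> ha /andP[k1 k2] /andP[k3 k4]; have d0 : 0 < d by lra.
  have k5 : (c - e) ^+ 2 < (d / 2) ^+ 2 by nra.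
  have k6 : 0 <= (c - (c - e) / 2) ^+ 2 by exact: sqr_ge0.
  case: (leP 0 a) ha => s; [rewrite ger0_norm // => ha|rewrite ltr0_norm // => ha]; nra.
case/orP: h => h; first by apply: H => //; apply/andP; split.
by rewrite addrC; apply: H => //; apply/andP; split.
Qed.

Definition angle_step x y : R := atan (cross x y / dot x y).

Lemma angle_stepxx x : angle_step x x = 0.
Proof. by rewrite /angle_step /cross [x.2 * _]mulrC subrr mul0r atan0. Qed.

Lemma continuous_angle_step (u w : R -> pt) : continuous u -> continuous w ->
  (forall t, 0 < dot (u t) (w t)) -> continuous (fun t => angle_step (u t) (w t)).
Proof.
move=> cu cw uw t.
have c1 (f : R -> pt) : continuous f -> {for t, continuous (fun t => (f t).1)}.
  by move=> cf; apply: (@continuous_comp _ _ _ f fst); [exact: cf|exact: cvg_fst].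
have c2 (f : R -> pt) : continuous f -> {for t, continuous (fun t => (f t).2)}.
  by move=> cf; apply: (@continuous_comp _ _ _ f snd); [exact: cf|exact: cvg_snd].
apply: (@continuous_comp _ _ _ (fun t =>
    cross (u t) (w t) / dot (u t) (w t)) (@atan R)); last exact: continuous_atan.
apply: continuousM.
  by apply: continuousB; apply: continuousM; (exact: c1) || (exact: c2).
apply: continuousV; first by rewrite gt_eqF.
by apply: continuousD; apply: continuousM; (exact: c1) || (exact: c2).
Qed.

Lemma continuous_sum n (F : 'I_n -> R -> R) : (forall k, continuous (F k)) ->
  continuous (fun t => \sum_k F k t).
Proof.
move=> cF t; apply: cvg_big => [|k _]; [exact: add_continuous|exact: cF].
Qed.

(** The retraction of the line onto the step from k / (n + 1) to (k + 1) / (n + 1). *)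
Definition kclamp (n k : nat) (t : R) : R :=
    (clamp (t * n.+1%:R - k%:R) + k%:R) / n.+1%:R.

Lemma continuous_kclamp n k : continuous (kclamp n k).
Proof.
move=> t; apply: cvgM; last exact: cvg_cst.
apply: cvgD; last exact: cvg_cst.
apply: (@continuous_comp _ _ _ (fun t => t * n.+1%:R - k%:R) clamp);
    last exact: continuous_clamp.
by apply: cvgB; [apply: cvgM; [exact: cvg_id|exact: cvg_cst]|exact: cvg_cst].
Qed.

Lemma kclamp_near n k t : `|k%:R / n.+1%:R - kclamp n k t| <= n.+1%:R^-1.
Proof.
have := clamp_itv (t * n.+1%:R - k%:R); rewrite /kclamp in_itv /= => /andP[h0 h1].
rewrite -mulrBl opprD addrCA subrr addr0 normrM normrN ger0_norm // ger0_norm ?invr_ge0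
    //.
by rewrite ler_piMl // invr_ge0.
Qed.

Lemma kclamp_itv n k t : (k <= n)%N -> kclamp n k t \in `[0, 1].
Proof.
move=> kn; have := clamp_itv (t * n.+1%:R - k%:R);
    rewrite /kclamp !in_itv /= => /andP[h0 h1].
move: (clamp _) h0 h1 => c h0 h1.
rewrite divr_ge0 ?addr_ge0 //= ler_pdivrMr ?ltr0n // mul1r -natr1.
by have : k%:R <= n%:R :> R by [rewrite ler_nat]; lra.
Qed.

Lemma frac_itv n k : (k <= n.+1)%N -> k%:R / n.+1%:R \in `[0, 1 : R].
Proof. by move=> kn; rewrite in_itv /= divr_ge0 //= ler_pdivrMr ?ltr0n // mul1r
    ler_nat. Qed.

(* Clamping t to each step of the subdivision writes the angle as one finite sum
   of continuous functions, so that no pieces have to be glued. *)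
Lemma lift_dir (F : R -> pt) n a :
  (forall t t', t \in `[0, 1] -> t' \in `[0, 1] -> `|t - t'| <= n.+1%:R^-1 ->
      0 < dot (F t) (F t')) ->
  angle_of (F 0) a ->
  forall t, t \in `[0, 1] ->
    angle_of (F t) (a + \sum_(k < n.+1) angle_step (F (k%:R / n.+1%:R)) (F (kclamp n k
        t))).
Proof.
move=> Fd Fa t t01.
have n0 : 0 < n.+1%:R :> R by rewrite ltr0n.
suff H m : (m <= n.+1)%N -> angle_of (F (Order.min t (m%:R / n.+1%:R)))
    (a + \sum_(k < m) angle_step (F (k%:R / n.+1%:R)) (F (kclamp n k t))).
  have := H n.+1 (leqnn _); rewrite divff ?gt_eqF // min_l //.
  by move: t01; rewrite in_itv => /andP[].
elim: m => [_|m IH mn].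
  by rewrite big_ord0 addr0 mul0r min_r //; move: t01; rewrite in_itv => /andP[].
rewrite big_ord_recr /= addrA.
have {}IH := IH (ltnW mn).
have e1 : kclamp n m t = Order.max (m%:R / n.+1%:R) (Order.min t (m.+1%:R / n.+1%:R)).
  rewrite /kclamp; apply: (mulIf (lt0r_neq0 n0)); rewrite divfK ?gt_eqF //.
  rewrite maxr_pMl ?ltW // minr_pMl ?ltW // !divfK ?gt_eqF //.
  by rewrite clampB natr1.
case: (leP t (m%:R / n.+1%:R)) => h.
  have h' : t <= m.+1%:R / n.+1%:R by rewrite (le_trans h) // ler_pM2r ?invr_gt0 //
      ler_nat.
  rewrite e1 !min_l // in IH *; rewrite max_l // angle_stepxx addr0 //.
rewrite (min_r (ltW h)) in IH.
rewrite e1 max_r; last by rewrite le_min (ltW h) /= ler_pM2r ?invr_gt0 // ler_nat.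
apply: angle_of_step => //; apply: Fd.
- by apply: frac_itv; exact: ltnW.
- move: t01; rewrite !in_itv /= => /andP[t0 t1]; rewrite le_min t0 /= divr_ge0 //=.
  by rewrite ge_min t1.
- have := kclamp_near n m t; rewrite e1 max_r //.
  by rewrite le_min (ltW h) /= ler_pM2r ?invr_gt0 // ler_nat.
Qed.

(** The angle is lifted along the side t = 0 and from there in the direction of t for each s;
    [clamp s] keeps the inner products positive for all real s. Continuity in each variable
    separately is enough, because the lift is only followed along sides of the square. *)
Lemma lift_square (f g : R -> pt) : continuous f -> continuous g ->
  (forall t s, t \in `[0, 1] -> s \in `[0, 1] -> f t <> g s) ->
  exists Th : R -> R -> R, [/\ forall s, continuous (fun t => Th t s),
    forall t, continuous (Th t) &
    forall t s, t \in `[0, 1] -> s \in `[0, 1] -> angle_of (f t - g s) (Th t s)].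
Proof.
move=> cf cg fg.
have [d d0 dfg] := curves_apart cf cg fg.
have d20 : 0 < d / 2 by rewrite divr_gt0.
have [n fn] := unif_step cf d20.
have [m gm] := unif_step cg d20.
have i0 : 0 \in `[0, 1 : R] by rewrite in_itv /= lexx ler01.
have [a Fa] : exists a, angle_of (f 0 - g 0) a.
  by apply: angle_of_exists => /eqP; rewrite subr_eq0 => /eqP; exact: fg.
have df t t' s : t \in `[0, 1] -> t' \in `[0, 1] -> s \in `[0, 1] ->
    `|t - t'| <= n.+1%:R^-1 ->
    0 < dot (f t - g s) (f t' - g s).
  move=> h1 h2 h3 h4; apply: dot_close (dfg t s h1 h3) _.
  by rewrite opprB addrA subrK; exact: fn.
have dg t s s' : t \in `[0, 1] -> s \in `[0, 1] -> s' \in `[0, 1] ->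
    `|s - s'| <= m.+1%:R^-1 ->
    0 < dot (f t - g s) (f t - g s').
  move=> h1 h2 h3 h4; apply: dot_close (dfg t s h1 h2) _.
  by rewrite opprB addrC addrA subrK distrC; exact: gm.
have ctk t : continuous (fun s => f t - g (clamp s)).
  move=> s; apply: continuousB; first exact: cst_continuous.
  by apply: continuous_comp; [exact: continuous_clamp|exact: cg].
exists (fun t s => (a + \sum_(k < m.+1) angle_step (f 0 - g (k%:R / m.+1%:R)) (f 0 - g
    (kclamp m k s)))
  + \sum_(k < n.+1) angle_step (f (k%:R / n.+1%:R) - g (clamp s)) (f (kclamp n k t) - g
        (clamp s))).
split.
- move=> s t; apply: cvgD; first exact: cvg_cst.
  apply: (continuous_sum (F := fun (k : 'I_n.+1) t =>
      angle_step (f (k%:R / n.+1%:R) - g (clamp s)) (f (kclamp n k t) - g (clamp s))))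
      => //=.
  move=> k; apply: continuous_angle_step.
  + by move=> ?; exact: cvg_cst.
  + move=> t'; apply: cvgB; last exact: cvg_cst.
    by apply: continuous_comp; [exact: continuous_kclamp|exact: cf].
  + move=> t'; apply: df; [exact: frac_itv (ltnW (ltn_ord k))|by apply: kclamp_itv;
        rewrite -ltnS|exact: clamp_itv|exact: kclamp_near].
- move=> t s; apply: cvgD.
    apply: cvgD; first exact: cvg_cst.
    apply: (continuous_sum (F := fun (k : 'I_m.+1) s =>
        angle_step (f 0 - g (k%:R / m.+1%:R)) (f 0 - g (kclamp m k s)))) => //=.
    move=> k; apply: continuous_angle_step.
    + by move=> ?; exact: cvg_cst.
    + move=> t'; apply: cvgB; first exact: cvg_cst.
      by apply: continuous_comp; [exact: continuous_kclamp|exact: cg].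
    + move=> t'; apply: dg; [exact: i0|exact: frac_itv (ltnW (ltn_ord k))|by apply:
          kclamp_itv; rewrite -ltnS|exact: kclamp_near].
  apply: (continuous_sum (F := fun (k : 'I_n.+1) s =>
      angle_step (f (k%:R / n.+1%:R) - g (clamp s)) (f (kclamp n k t) - g (clamp s))))
      => //=.
  move=> k; apply: continuous_angle_step => // s'.
  apply: df; [exact: frac_itv (ltnW (ltn_ord k))|by apply: kclamp_itv;
      rewrite -ltnS|exact: clamp_itv|exact: kclamp_near].
- move=> t s t01 s01; rewrite clampE //.
  apply: (lift_dir (F := fun t => f t - g s)) => //.
    by move=> t1 t2 h1 h2; exact: df.
  apply: (lift_dir (F := fun s => f 0 - g s)) => //.
  by move=> t1 t2 h1 h2; exact: dg.
Qed.

End Plane.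

(** * Variation of the angle along a curve *)

Section Winding.
Variable R : realType.
Notation pt := (R * R)%type.
Implicit Types (x y : pt) (a b t : R).

Lemma in01_0 : 0 \in `[0, 1 : R]. Proof. by rewrite in_itv /= lexx ler01. Qed.
Lemma in01_1 : 1 \in `[0, 1 : R]. Proof. by rewrite in_itv /= lexx ler01. Qed.

Lemma no_cross (h : R -> R) v : continuous h ->
  (forall t, t \in `[0, 1] -> h t <> v) -> h 0 < v -> h 1 < v.
Proof.
move=> ch hv h0; rewrite ltNge; apply/negP => h1.
have [|||c c01 hc] := @IVT R h 0 1 v; first exact: ler01.
- exact: continuous_subspaceT.
- by rewrite ge_min (ltW h0) /= le_max h1 orbT.
by apply: (hv c).
Qed.

Lemma continuous_opp_fun (h : R -> R) : continuous h -> continuous (fun t => - h t).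
Proof. by move=> ch t; apply: cvgN; exact: ch. Qed.

Lemma cos1_const (h : R -> R) : continuous h ->
  (forall t, t \in `[0, 1] -> cos (h t) = 1) -> h 1 = h 0.
Proof.
have p0 := @pi_gt0 R.
suff H (k : R -> R) : continuous k -> (forall t, t \in `[0, 1] -> cos (k t) = 1) ->
    k 1 <= k 0.
  move=> ch hc; apply/eqP; rewrite eq_le H //=.
  have := H (fun t => - h t); rewrite lerN2; apply; first exact: continuous_opp_fun.
  by move=> t /hc; rewrite cosN.
move=> ck kc; rewrite leNgt; apply/negP => k01.
(* A value strictly between k 0 and k 1, and at most pi above k 0, is not congruent to k 0 modulo 2
   pi, so its cosine is not 1. *)
pose v := Order.min ((k 0 + k 1) / 2) (k 0 + pi).
have v1 : k 0 < v by rewrite lt_min; apply/andP; split; lra.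
have v2 : v < k 1 by rewrite gt_min; apply/orP; left; lra.
have v3 : v <= k 0 + pi by rewrite ge_min lexx orbT.
have : k 1 < v; last by lra.
apply: no_cross => // t t01 ktv.
have [m km] := cos_eq1_int (kc 0 in01_0).
have : v - k 0 = 0; last by lra.
apply: cos_eq1_2pi; last by lra.
by rewrite km -mulNr -mulrNz cosD2pin -ktv kc.
Qed.

(** The function cannot pass through pi / 2 or - pi / 2, where the cosine vanishes. The transport
    runs from 1 to 0, as it will from the outer circle of an annulus to the inner one. *)
Lemma cos_pos_transport (h : R -> R) : continuous h ->
  (forall t, t \in `[0, 1] -> 0 < cos (h t)) ->
  -(pi / 2) < h 1 < pi / 2 -> -(pi / 2) < h 0 < pi / 2.
Proof.
have p0 := @pi_gt0 R.
suff H (k : R -> R) : continuous k -> (forall t, t \in `[0, 1] -> 0 < cos (k t)) ->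
    k 1 < pi / 2 -> k 0 < pi / 2.
  move=> ch hc /andP[h1 h2]; apply/andP; split; last exact: H.
  rewrite ltrNl; have := H (fun t => - h t); apply; first exact: continuous_opp_fun.
    by move=> t /hc; rewrite cosN.
  by rewrite ltrNl.
move=> ck kc k1.
have := @no_cross (fun t => k (1 - t)) (pi / 2); rewrite subr0 subrr; apply => //.
  move=> t; apply: (@continuous_comp _ _ _ (fun t => 1 - t) k); last exact: ck.
  by apply: cvgB; [exact: cvg_cst|exact: cvg_id].
move=> t t01 e; have := kc (1 - t).
rewrite e cos_pihalf ltxx => H; suff: false by []; apply: H.
by move: t01; rewrite !in_itv /=; lra.
Qed.

Definition is_lift (f : R -> pt) (th : R -> R) :=
  continuous th /\ forall t, t \in `[0, 1] -> angle_of (f t) (th t).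

Lemma lift_unique f th th' : is_lift f th -> is_lift f th' ->
    th 1 - th 0 = th' 1 - th' 0.
Proof.
move=> [c1 l1] [c2 l2].
suff H : th 1 - th' 1 = th 0 - th' 0 by lra.
apply: (@cos1_const (fun t => th t - th' t)).
  by move=> t; apply: cvgB; [exact: c1|exact: c2].
by move=> t t01; apply: angle_of_cos1 (l2 t t01) (l1 t t01).
Qed.

(* Junk value 0 if f vanishes somewhere on [0, 1]. *)
Definition angle_var (f : R -> pt) : R :=
  xget 0 [set A | exists2 th, is_lift f th & A = th 1 - th 0].

Lemma angle_varE f th : is_lift f th -> angle_var f = th 1 - th 0.
Proof.
move=> l; rewrite /angle_var; case: xgetP => [A _ [th' l' ->]|/(_ (th 1 - th 0)) []].
  exact: lift_unique l' l.
by exists th.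
Qed.

(** The four variations are differences of one function at the corners of the square, so they cancel
    around its boundary. *)
Lemma angle_var_square (f g : R -> pt) : continuous f -> continuous g ->
  (forall t s, t \in `[0, 1] -> s \in `[0, 1] -> f t <> g s) ->
  angle_var (fun t => f t - g 1) - angle_var (fun t => f t - g 0) =
  angle_var (fun s => f 1 - g s) - angle_var (fun s => f 0 - g s).
Proof.
move=> cf cg fg; have [Th [c1 c2 l]] := lift_square cf cg fg.
have [i0 i1] := (in01_0, in01_1).
have -> : angle_var (fun t => f t - g 1) = Th 1 1 - Th 0 1.
  by apply: (@angle_varE _ (Th^~ 1)); split=> // t t01; exact: l.
have -> : angle_var (fun t => f t - g 0) = Th 1 0 - Th 0 0.
  by apply: (@angle_varE _ (Th^~ 0)); split=> // t t01; exact: l.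
have -> : angle_var (fun s => f 1 - g s) = Th 1 1 - Th 1 0.
  by apply: (@angle_varE _ (Th 1)); split=> // s s01; exact: l.
have -> : angle_var (fun s => f 0 - g s) = Th 0 1 - Th 0 0.
  by apply: (@angle_varE _ (Th 0)); split=> // s s01; exact: l.
ring.
Qed.

Definition polar (r a : R) : pt := (r * cos a, r * sin a).

Lemma angle_of_polar r a : 0 < r -> angle_of (polar r a) a.
Proof. by exists r. Qed.

Lemma continuous_affine a b : continuous (fun s : R => a + b * s).
Proof.
move=> s; apply: cvgD; first exact: cvg_cst.
by apply: cvgM; [exact: cvg_cst|exact: cvg_id].
Qed.

Lemma continuous_pair (f g : R -> R) : continuous f -> continuous g ->
    continuous (fun t => (f t, g t)).
Proof. by move=> cf cg t; exact: cvg_pair (cf t) (cg t). Qed.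

Lemma continuous_polar (r : R -> R) (th : R -> R) : continuous r -> continuous th ->
  continuous (fun s => polar (r s) (th s)).
Proof.
move=> cr ch; apply: continuous_pair => t; apply: cvgM; (try exact: cr).
  by apply: continuous_comp; [exact: ch|exact: continuous_cos].
by apply: continuous_comp; [exact: ch|exact: continuous_sin].
Qed.

Lemma angle_var_halfplane (f : R -> pt) x : continuous f ->
    (forall t, 0 < dot x (f t)) ->
  angle_var f = angle_step x (f 1) - angle_step x (f 0).
Proof.
move=> cf d.
have [a xa] : exists a, angle_of x a.
  by apply: angle_of_exists => x0; have := d 0; rewrite x0 /dot /= !mul0r addr0 ltxx.
rewrite (@angle_varE _ (fun t => a + angle_step x (f t))); first by ring.
split=> [t|t _]; last exact: angle_of_step.
apply: cvgD; first exact: cvg_cst.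
by apply: (continuous_angle_step (u := fun=> x)) => // s; exact: cvg_cst.
Qed.

(** The point y lies in the closed disc around 0 through x, on the inner side of the tangent at x.
    In formulas, 2 x.(x - y) = |x|^2 - |y|^2 + |x - y|^2. *)
Lemma dot_outer x y : dot y y <= dot x x -> x <> y -> 0 < dot x (x - y).
Proof.
case: x => x1 x2; case: y => y1 y2; rewrite /dot /= => h ne.
have : 0 < (x1 - y1) ^+ 2 + (x2 - y2) ^+ 2; last by nra.
rewrite lt_def addr_ge0 ?sqr_ge0 // andbT; apply/eqP => /eqP.
rewrite paddr_eq0 ?sqr_ge0 // !sqrf_eq0 !subr_eq0 => /andP[/eqP e1 /eqP e2].
by apply: ne; rewrite e1 e2.
Qed.

Lemma angle_ofN x a : angle_of x a -> angle_of (- x) (a - pi).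
Proof.
move=> [r r0 ->]; exists r => //.
rewrite -(cosN (a - pi)) -[sin (a - pi)]opprK -sinN opprB.
by rewrite [pi - a]addrC cosDpi sinDpi cosN sinN opprK !mulrN.
Qed.

Lemma annulus_pair (f g : R -> pt) (th et : R -> R) : continuous f -> continuous g ->
  (forall t s, t \in `[0, 1] -> s \in `[0, 1] -> f t <> g s) ->
  is_lift f th -> is_lift g et ->
  dot (f 0) (f 0) = dot (g 0) (g 0) -> dot (f 1) (f 1) = dot (g 1) (g 1) ->
  (forall t, t \in `[0, 1] -> dot (f 0) (f 0) <= dot (f t) (f t) <= dot (f 1) (f 1)) ->
  (forall t, t \in `[0, 1] -> dot (g 0) (g 0) <= dot (g t) (g t) <= dot (g 1) (g 1)) ->
  0 < et 1 - th 1 < 2 * pi -> 0 < et 0 - th 0 < 2 * pi.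
Proof.
move=> cf cg fg [cth lth] [cet let_] e0 e1 hf hg /andP[d1 d2].
have p0 := @pi_gt0 R.
have [Th [c1 c2 l]] := lift_square cf cg fg.
have [i0 i1] := (in01_0, in01_1).
have ne t s : t \in `[0, 1] -> s \in `[0, 1] -> g s <> f t by move=> ? ? /esym;
    exact: fg.
have F0 t : t \in `[0, 1] -> 0 < cos (Th t 0 - th t).
  move=> t01; apply: cos_angle_of_gt0 (lth t t01) (l t 0 t01 i0) _.
  by apply: dot_outer; [rewrite -e0; case/andP: (hf t t01)|exact: fg].
have F1 s : s \in `[0, 1] -> 0 < cos (Th 1 s - th 1).
  move=> s01; apply: cos_angle_of_gt0 (lth 1 i1) (l 1 s i1 s01) _.
  by apply: dot_outer; [rewrite e1; case/andP: (hg s s01)|exact: fg].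
have oppdot x y : dot (- x) (y - x) = dot x (x - y) by rewrite /dot /=; ring.
have G0 s : s \in `[0, 1] -> 0 < cos (Th 0 s - (et s - pi)).
  move=> s01; apply: cos_angle_of_gt0 (angle_ofN (let_ s s01)) (l 0 s i0 s01) _.
  by rewrite oppdot; apply: dot_outer; [rewrite e0; case/andP: (hg s s01)|exact: ne].
have G1 t : t \in `[0, 1] -> 0 < cos (Th t 1 - (et 1 - pi)).
  move=> t01; apply: cos_angle_of_gt0 (angle_ofN (let_ 1 i1)) (l t 1 t01 i1) _.
  by rewrite oppdot; apply: dot_outer; [rewrite -e1; case/andP: (hf t t01)|exact: ne].
(* Shifting the lift by whole turns puts its value at (1, 1) within pi of [th 1], hence within pi /
   2. Since [et 1 - pi] is within pi of [th 1], the lift is then within 3 pi / 2 of it, and again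
   within pi / 2. *)
have [m /andP[m1 m2]] := shift_2pi (th 1 - pi) (Th 1 1).
set M := m%:~R * (2 * pi) in m1 m2.
have cM a : cos (a + M) = cos a by exact: cosD2pin.
have /andP[k1 k2] : -(pi / 2) < Th 1 1 + M - th 1 < pi / 2.
  by apply: cos_gt0_small; [rewrite addrAC cM F1|lra].
have /andP[k3 k4] : -(pi / 2) < Th 1 1 + M - (et 1 - pi) < pi / 2.
  by apply: cos_gt0_small; [rewrite addrAC cM G1|lra].
have cB (h k : R -> R) : continuous h -> continuous k ->
    continuous (fun t => h t + M - k t).
  by move=> ch ck t; apply: cvgB; [apply: cvgD; [exact: ch|exact: cvg_cst]|exact: ck].
have cc (c : R) : continuous (fun _ : R => c) by move=> t; exact: cvg_cst.
have A1 : -(pi / 2) < Th 1 0 + M - th 1 < pi / 2.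
  apply: (@cos_pos_transport (fun s => Th 1 s + M - th 1));
      [exact: cB| |by rewrite k1 k2].
  by move=> s s01; rewrite addrAC cM F1.
have /andP[A2 A3] : -(pi / 2) < Th 0 0 + M - th 0 < pi / 2.
  apply: (@cos_pos_transport (fun t => Th t 0 + M - th t)) => //;
      first exact: (cB (Th^~ 0)).
  by move=> s s01; rewrite addrAC cM F0.
have B1 : -(pi / 2) < Th 0 1 + M - (et 1 - pi) < pi / 2.
  apply: (@cos_pos_transport (fun t => Th t 1 + M - (et 1 - pi)));
      [exact: (cB (Th^~ 1))| |by rewrite k3 k4].
  by move=> s s01; rewrite addrAC cM G1.
have /andP[B2 B3] : -(pi / 2) < Th 0 0 + M - (et 0 - pi) < pi / 2.
  apply: (@cos_pos_transport (fun s => Th 0 s + M - (et s - pi))) => //.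
    by apply: (cB _ (fun s => et s - pi)) => // s; apply: cvgB;
        [exact: cet|exact: cvg_cst].
  by move=> s s01; rewrite addrAC cM G0.
(* The value at (0, 0), reached along two sides in both ways, is within pi / 2 of [th 0] and of
   [et 0 - pi]; so these two differ by less than pi. *)
by apply/andP; split; lra.
Qed.

End Winding.

(** * Counterclockwise listings of the neighbors *)

Section Times.
Variable R : realType.
Implicit Types (D : R -> R) (c t : R).

Lemma last_time D c : continuous D -> D 0 <= c -> c < D 1 ->
  exists t, [/\ t \in `[0, 1], D t = c & forall s, s \in `]t, 1] -> c < D s].
Proof.
move=> cD h0 h1.
have cA : compact (`[0, 1] `&` [set t | D t <= c]).
  apply: compact_closedI; first exact: segment_compact.
  by apply: (@closed_comp _ _ D [set x | x <= c]); [move=> t _;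
      exact: cD|exact: closed_le].
have A0 : (`[0, 1] `&` [set t | D t <= c]) !=set0 by exists 0; split => //=;
    exact: in01_0.
have [|t] := @compact_EVT_max _ R id _ A0 cA.
  by apply: continuous_subspaceT => t; exact: cvg_id.
rewrite inE => -[/= t01 Dt] tmax.
have up s : s \in `]t, 1] -> c < D s.
  rewrite in_itv /= => /andP[ts s1]; rewrite ltNge; apply/negP => Ds.
  have : s <= t; last by rewrite leNgt ts.
  apply: tmax; rewrite inE; split => //=; rewrite in_itv /= s1 andbT.
  by move: t01; rewrite in_itv /= => /andP[t0 _]; rewrite (le_trans t0) // ltW.
exists t; split => //; apply/eqP; rewrite eq_le Dt /= leNgt; apply/negP => Dtc.
have t1 : t <= 1 by move: t01; rewrite in_itv /= => /andP[].
have [||s s01 Ds] := @IVT R D t 1 c t1; first exact: continuous_subspaceT.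
  by rewrite ge_min Dt /= le_max (ltW h1) orbT.
have : c < D s; last by rewrite Ds ltxx.
apply: up; move: s01; rewrite !in_itv /= => /andP[ts ->]; rewrite andbT lt_def ts andbT.
by apply/eqP => st; move: Ds; rewrite st; lra.
Qed.

Lemma first_time D c : continuous D -> D 0 < c -> c <= D 1 ->
  exists t, [/\ t \in `[0, 1], D t = c & forall s, s \in `[0, t[ -> D s < c].
Proof.
move=> cD h0 h1.
have [|||t [t01 Dt H]] := @last_time (fun t => - D (1 - t)) (- c);
    rewrite ?subrr ?subr0 ?lerN2 ?ltrN2 //.
  move=> t; apply: cvgN; apply: (@continuous_comp _ _ _ (fun t => 1 - t) D);
      last exact: cD.
  by apply: cvgB; [exact: cvg_cst|exact: cvg_id].
exists (1 - t); split; [by move: t01; rewrite !in_itv /=; lra|by lra|].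
move=> s; rewrite in_itv /= => /andP[s0 s1]; have := H (1 - s).
rewrite subKr ltrN2; apply; rewrite in_itv /=; move: t01; rewrite in_itv /=; lra.
Qed.

Lemma continuous_dot (f : R -> R * R) : continuous f ->
    continuous (fun t => dot (f t) (f t)).
Proof.
move=> cf t.
have c1 : {for t, continuous (fun t => (f t).1)}.
  by apply: (@continuous_comp _ _ _ f fst); [exact: cf|exact: cvg_fst].
have c2 : {for t, continuous (fun t => (f t).2)}.
  by apply: (@continuous_comp _ _ _ f snd); [exact: cf|exact: cvg_snd].
by apply: cvgD; apply: cvgM; (exact: c1) || (exact: c2).
Qed.

Lemma dot_ge0 (x : R * R) : 0 <= dot x x.
Proof. by rewrite addr_ge0 // -expr2 sqr_ge0. Qed.

Lemma dot_gt0 (x : R * R) : x <> 0 -> 0 < dot x x.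
Proof.
move=> x0; rewrite lt_def dot_ge0 andbT; apply/eqP => /eqP.
rewrite /dot -!expr2 paddr_eq0 ?sqr_ge0 // !sqrf_eq0 => /andP[/eqP e1 /eqP e2].
by apply: x0; rewrite [x]surjective_pairing e1 e2.
Qed.

Lemma dot_polar (r a : R) : dot (polar r a) (polar r a) = r ^+ 2.
Proof. by rewrite /dot /= -[RHS]mulr1 -(cos2Dsin2 a); ring. Qed.

Lemma eucl_distE (p q : R * R) : eucl_dist p q = Num.sqrt (dot (p - q) (p - q)).
Proof. by rewrite /eucl_dist /dot /= !expr2. Qed.

Lemma lt_eucl_dist (p q : R * R) (r : R) : 0 <= r ->
  (r < eucl_dist p q) = (r ^+ 2 < dot (p - q) (p - q)).
Proof.
move=> r0; rewrite eucl_distE -(@ltr_pXn2r _ 2) ?nnegrE ?sqrtr_ge0 //.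
by rewrite sqr_sqrtr // dot_ge0.
Qed.

Lemma eucl_dist_eq (p q : R * R) (r : R) : 0 <= r ->
  (eucl_dist p q == r) = (dot (p - q) (p - q) == r ^+ 2).
Proof.
move=> r0; rewrite eucl_distE.
by rewrite -[RHS](@eqr_sqrt R) ?dot_ge0 ?sqr_ge0 // sqrtr_sqr ger0_norm.
Qed.

Lemma angle_of_norm (x : R * R) a r : 0 < r -> angle_of x a -> dot x x = r ^+ 2 ->
    x = polar r a.
Proof.
move=> r0 [s s0 ->]; rewrite -/(polar s a) dot_polar => /eqP.
by rewrite eqrXn2 ?ltW // => /eqP ->.
Qed.

Lemma lift_exists (f : R -> R * R) a : continuous f ->
  (forall t, t \in `[0, 1] -> f t <> 0) -> angle_of (f 1) a ->
  exists2 th, is_lift f th & th 1 = a.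
Proof.
move=> cf f0 fa.
(* With the constant curve 0 for g, the lift on the square contains a lift of f itself. *)
have [||Th [c1 _ l]] := lift_square cf (g := fun=> 0).
- by move=> t; exact: cvg_cst.
- by move=> t s t01 _; exact: f0.
have := l 1 0 (in01_1 R) (in01_0 R); rewrite subr0 => l1.
have [m e] := cos_eq1_int (angle_of_cos1 l1 fa).
exists (fun t => Th t 0 + m%:~R * (2 * pi)); last by rewrite -e addrC subrK.
split=> [t|t t01]; first by apply: cvgD; [exact: c1|exact: cvg_cst].
by apply: angle_ofD2pi; have := l t 0 t01 (in01_0 R); rewrite subr0.
Qed.

End Times.

Lemma near_forall (T : Type) (I : finType) (P : I -> T -> Prop) (F : set_system T) :
  Filter F -> (forall i, \forall x \near F, P i x) ->
      \forall x \near F, forall i, P i x.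
Proof.
move=> FF H; have := @filter_forall T I (fun i => [set x | P i x]) F FF H.
by apply: filterS => x h i; exact: h.
Qed.

Section Listing.
Variables (R : realType) (G : plane_graph R).
Implicit Types v w : G.

Definition rel_arc v w (t : R) : R * R := edge_arc v w (clamp t) - pos v.

Lemma adjC v w : adj v w = adj w v. Proof. exact: adj_sym. Qed.

Lemma arc_end v w : adj v w -> edge_arc v w 1 = pos w.
Proof.
move=> vw; have wv : adj w v by rewrite adjC.
by rewrite (arc_rev wv) ?subrr ?arc_start //; exact: in01_1.
Qed.

Lemma adj_neq v w : adj v w -> v != w.
Proof. by apply: contraTneq => ->; rewrite adj_irrefl. Qed.

Lemma continuous_rel_arc v w : adj v w -> continuous (rel_arc v w).
Proof.
move=> vw t; apply: cvgB; last exact: cvg_cst.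
exact: (continuous_clamp_comp (arc_continuous vw)).
Qed.

Lemma rel_arc0 v w : adj v w -> rel_arc v w 0 = 0.
Proof. by move=> vw; rewrite /rel_arc clampE ?arc_start ?subrr //; exact: in01_0. Qed.

Lemma rel_arc1 v w : adj v w -> rel_arc v w 1 = pos w - pos v.
Proof. by move=> vw; rewrite /rel_arc clampE ?arc_end //; exact: in01_1. Qed.

Lemma rel_arc_neq0 v w t : adj v w -> t \in `]0, 1] -> rel_arc v w t <> 0.
Proof.
move=> vw; rewrite in_itv /= => /andP[t0]; rewrite le_eqVlt => /orP[/eqP->|t1] e.
  move/eqP: e; rewrite rel_arc1 // subr_eq0 => /eqP /pos_inj e.
  by move: (adj_neq vw); rewrite e eqxx.
move/eqP: e; rewrite /rel_arc subr_eq0 clampE; last by rewrite in_itv /= !ltW.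
by move/eqP; apply: arc_avoids_vertices => //; rewrite in_itv /= t0.
Qed.

Lemma rel_arc_disj v w w' t s : adj v w -> adj v w' -> w != w' ->
  t \in `]0, 1[ -> s \in `]0, 1[ -> rel_arc v w t <> rel_arc v w' s.
Proof.
move=> vw vw' ww' t01 s01 /addIr; rewrite !clampE.
- apply: arcs_do_not_cross => //.
  apply: contra_neq ww' => /setP /(_ w); rewrite !inE eqxx orbT.
  by move/esym; rewrite eq_sym (negbTE (adj_neq vw)) => /eqP.
- by move: s01; rewrite !in_itv /= => /andP[? ?]; rewrite !ltW.
- by move: t01; rewrite !in_itv /= => /andP[? ?]; rewrite !ltW.
Qed.

(* The part of the edge between the last exit from the small disc and the first
   exit from the big one. *)
Definition annulus_arc v w (r B a b : R) :=
  exists f th, [/\ continuous f, is_lift f th,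
    (forall t, t \in `[0, 1] -> exists2 s, s \in `]0, 1[ & f t = rel_arc v w s) &
    [/\ dot (f 0) (f 0) = r ^+ 2, dot (f 1) (f 1) = B ^+ 2,
     (forall t, t \in `[0, 1] -> r ^+ 2 <= dot (f t) (f t) <= B ^+ 2),
     th 0 = a & th 1 = b]].

(** The angle b belongs to the first point of the edge on the circle of radius B, so it is the same
    for all small r; this is what makes the orders at different r comparable. *)
Lemma annulus_arc_exists v w (B : R) : adj v w -> 0 < B ->
  B ^+ 2 < dot (pos w - pos v) (pos w - pos v) ->
  exists b, [/\ 0 <= b < 2 * pi,
    (exists2 s, s \in `]0, 1[ & rel_arc v w s = polar B b) &
    \forall r \near (0 : R)^'+, exists2 a, annulus_arc v w r B a b &
      last_exit v w r ((pos v).1 + r * cos a, (pos v).2 + r * sin a)].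
Proof.
move=> vw B0 Bw.
set f := rel_arc v w; have cf : continuous f by exact: continuous_rel_arc.
pose D t := dot (f t) (f t); have cD : continuous D by exact: continuous_dot.
have D0 : D 0 = 0 by rewrite /D /f rel_arc0 // /dot /= !mul0r addr0.
have D1 : D 1 = dot (pos w - pos v) (pos w - pos v) by rewrite /D /f rel_arc1.
have Dpos t : t \in `]0, 1] -> 0 < D t by move=> t01; apply: dot_gt0;
    exact: rel_arc_neq0.
have B20 : 0 < B ^+ 2 by exact: exprn_gt0.
have [||T [T01 DT TB]] := first_time cD (c := B ^+ 2); rewrite ?D0 ?D1 ?ltW //.
have T0 : 0 < T.
  move: T01; rewrite in_itv /= => /andP[T0 _]; rewrite lt_def T0 andbT.
  by apply/eqP => e; move: DT; rewrite e D0; lra.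
have T1 : T < 1.
  move: T01; rewrite in_itv /= => /andP[_ T1]; rewrite lt_def T1 andbT.
  by apply/eqP => e; move: DT; rewrite -e D1; lra.
have Ti : T \in `]0, 1[ by rewrite in_itv /= T0 T1.
have fT0 : f T <> 0 by apply: rel_arc_neq0 => //; rewrite in_itv /= T0 ltW.
have [b fb] := angle_of_in 0 fT0; rewrite add0r => b2.
exists b; split => //; first by exists T => //; exact: angle_of_norm.
(* After the first hit T of the outer circle the edge keeps a positive distance from v. For r below
   this distance the last exit comes before T, and the edge between the two times lies in the
   annulus. *)
have [||m mT mmin] := @EVT_min R D T 1; [exact: ltW|exact: continuous_subspaceT|].
have m0 : 0 < D m.
  by apply: Dpos; move: mT; rewrite !in_itv /= => /andP[h ->]; rewrite (lt_le_trans T0).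
have sm0 : 0 < Num.sqrt (D m) by rewrite sqrtr_gt0.
near=> r.
have r0 : 0 < r by near: r; exact: nbhs_right_gt.
have rm : r < Num.sqrt (D m) by near: r; exact: nbhs_right_lt.
have {}rm : r ^+ 2 < D m by rewrite -(sqr_sqrtr (ltW m0)) ltr_pXn2r // ?nnegrE ?ltW.
have [||t [t01 Dt tr]] := last_time cD (c := r ^+ 2).
- by rewrite D0 sqr_ge0.
- by apply: (lt_le_trans rm); apply: mmin; rewrite in_itv /= lexx ltW.
have t0 : 0 < t.
  move: t01; rewrite in_itv /= => /andP[t0 _]; rewrite lt_def t0 andbT.
  by apply/eqP => e; move: Dt; rewrite e D0; have := exprn_gt0 2 r0; lra.
have tT : t < T.
  rewrite ltNge; apply/negP => h; have : D m <= D t; last by rewrite Dt; lra.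
  by apply: mmin; rewrite in_itv /= h; move: t01; rewrite in_itv /= => /andP[].
pose g s := f (t + (T - t) * clamp s).
have cg : continuous g.
  move=> s; apply: (@continuous_comp _ _ _ (fun s => t + (T - t) * clamp s) f);
      last exact: cf.
  apply: cvgD; first exact: cvg_cst.
  by apply: cvgM; [exact: cvg_cst|exact: continuous_clamp].
have g_itv s : s \in `[0, 1] -> t + (T - t) * clamp s \in `[t, T].
  by move=> s01; rewrite clampE //; move: s01; rewrite !in_itv /=; nra.
have g0 : g 0 = f t by rewrite /g clampE ?mulr0 ?addr0 //; exact: in01_0.
have g1 : g 1 = f T by rewrite /g clampE ?mulr1 1?addrC ?subrK //; exact: in01_1.
have [||th lth th1] := @lift_exists R g b cg; last 1 first.
- exists (th 0); last first.
    have ea : f t = polar r (th 0).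
      by apply: angle_of_norm => //; rewrite -g0; apply: lth.2; exact: in01_0.
    exists t; split => //.
    + have := congr1 (+%R (pos v)) ea;
          rewrite /f /rel_arc clampE // addrCA subrr addr0 => ->.
      by rewrite [pos v]surjective_pairing.
    + apply/eqP; rewrite eucl_dist_eq ?ltW //.
      have -> : ((pos v).1 + r * cos (th 0),
          (pos v).2 + r * sin (th 0)) - pos v = polar r (th 0).
        by rewrite [pos v]surjective_pairing; congr pair => /=; ring.
      by rewrite dot_polar.
    + move=> s s1; rewrite lt_eucl_dist ?ltW //.
      have := tr s s1; rewrite /D /f /rel_arc clampE //.
      by move: s1 t01; rewrite !in_itv /= => /andP[h ->] /andP[h' _];
          rewrite andbT ltW // (le_lt_trans h').
  exists g, th; split => //.
    move=> s s01; exists (t + (T - t) * clamp s) => //.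
    by have := g_itv s s01; rewrite !in_itv /=; lra.
  split => //; [by rewrite g0|by rewrite g1|].
  move=> s s01; have := g_itv s s01; rewrite in_itv /= => /andP[h1 h2].
  apply/andP; split.
    move: h1; rewrite le_eqVlt => /orP[/eqP e|h1]; first by rewrite /g -e -/(D t) Dt.
    by apply: ltW; apply: tr; rewrite in_itv /= h1 /=; lra.
  move: h2; rewrite le_eqVlt => /orP[/eqP e|h2]; first by rewrite /g e -/(D T) DT.
  by apply: ltW; apply: TB; rewrite in_itv /= h2 andbT; lra.
- move=> s s01; apply: rel_arc_neq0 => //; have := g_itv s s01; rewrite !in_itv /=; lra.
- by rewrite g1.
Unshelve. all: by end_near.
Qed.

Lemma annulus_arc_pair v w w' (r B a b a' b' : R) : adj v w -> adj v w' -> w != w' ->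
  annulus_arc v w r B a b -> annulus_arc v w' r B a' b' ->
  0 < b' - b < 2 * pi -> 0 < a' - a < 2 * pi.
Proof.
move=> vw vw' ww' [f [th [cf lf af [f0 f1 nf <- <-]]]] [g [et [cg lg ag [g0 g1 ng <-
    <-]]]].
apply: (annulus_pair cf cg _ lf lg); rewrite ?f0 ?f1 ?g0 ?g1 //.
move=> t s t01 s01; have [x x01 ->] := af t t01; have [y y01 ->] := ag s s01.
exact: rel_arc_disj.
Qed.

(** The neighbors are sorted by the angles at which their edges first hit one fixed circle; these
    angles are distinct because the edges are disjoint. [annulus_arc_pair] carries the order to the
    last exits from every small disc. *)
Lemma ccw_listing_exists v : exists n : 'I_(deg v) -> G,
  [/\ injective n, [set n i | i : 'I_(deg v)]%SET = neighbors v & counterclockwise v n].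
Proof.
have p0 := @pi_gt0 R.
have [B [B0 BP]] : exists B : R, 0 < B /\ forall w : G, adj v w ->
    B ^+ 2 < dot (pos w - pos v) (pos w - pos v).
  suff H : \forall B \near (0 : R)^'+, forall w : G, adj v w ->
      B ^+ 2 < dot (pos w - pos v) (pos w - pos v).
    have [B [B0 BP]] := filter_ex (filterI (nbhs_right_gt (0 : R)) H).
    by exists B.
  apply: (@near_forall _ G (fun w B => adj v w ->
      B ^+ 2 < dot (pos w - pos v) (pos w - pos v))) => w.
  case: (boolP (adj v w)) => [vw|_]; last exact: nearW.
  have d0 : 0 < dot (pos w - pos v) (pos w - pos v).
    apply: dot_gt0 => /eqP; rewrite subr_eq0 => /eqP /pos_inj e.
    by move: (adj_neq vw); rewrite e eqxx.
  near=> B => _; have B0 : 0 < B by near: B; exact: nbhs_right_gt.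
  have : B < Num.sqrt (dot (pos w - pos v) (pos w - pos v)).
    by near: B; apply: nbhs_right_lt; rewrite sqrtr_gt0.
  by rewrite -{2}(sqr_sqrtr (ltW d0)) ltr_pXn2r // ?nnegrE ?sqrtr_ge0 ?ltW.
have /choice[b bP] : forall w, exists b, adj v w -> [/\ 0 <= b < 2 * pi,
    (exists2 s, s \in `]0, 1[ & rel_arc v w s = polar B b) &
    \forall r \near (0 : R)^'+, exists2 a, annulus_arc v w r B a b &
      last_exit v w r ((pos v).1 + r * cos a, (pos v).2 + r * sin a)].
  move=> w.
  case: (boolP (adj v w)) => [vw|_]; last by exists 0.
  by have [b h] := annulus_arc_exists vw B0 (BP w vw); exists b.
have b_inj w w' : adj v w -> adj v w' -> b w = b w' -> w = w'.
  move=> vw vw' e; apply/eqP; apply: contraT => ww'.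
  have [_ [s s01 es] _] := bP w vw; have [_ [t t01 et] _] := bP w' vw'.
  by have := rel_arc_disj vw vw' ww' s01 t01; rewrite es et e.
pose s := sort (fun u w => b u <= b w) (enum (neighbors v)).
have sz : size s = deg v by rewrite size_sort -cardE.
have su : uniq s by rewrite sort_uniq enum_uniq.
have sm w : (w \in s) = adj v w by rewrite mem_sort mem_enum inE.
have nP (i : 'I_(deg v)) : adj v (nth v s i) by rewrite -sm mem_nth // sz.
exists (fun i => nth v s i); split.
- by move=> i j /eqP; rewrite nth_uniq ?sz // => /eqP /val_inj.
- apply/setP => w; rewrite inE -sm; apply/imsetP/idP => [[i _ ->]|ws];
      first by rewrite sm.
  have wi : (index w s < deg v)%N by rewrite -sz index_mem.
  by exists (Ordinal wi) => //=; rewrite nth_index.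
have bord (i j : 'I_(deg v)) : (i < j)%N -> 0 < b (nth v s j) - b (nth v s i) < 2 * pi.
  move=> ij; have [/andP[h1 h2] _ _] := bP _ (nP i);
      have [/andP[h3 h4] _ _] := bP _ (nP j).
  have : b (nth v s i) <= b (nth v s j).
    apply: (sorted_leq_nth (leT := fun u w => b u <= b w)) => //.
    + by move=> x y z; exact: le_trans.
    + by apply: sort_sorted => x y; exact: le_total.
    + by rewrite inE sz.
    + by rewrite inE sz.
    + exact: ltnW.
  rewrite le_eqVlt => /orP[/eqP /b_inj e|]; last by lra.
  have /eqP := e (nP i) (nP j); rewrite nth_uniq ?sz // => /eqP e'.
  by move: ij; rewrite e' ltnn.
rewrite /counterclockwise; near=> r.
have /choice[a aP] : forall w, exists a, adj v w -> annulus_arc v w r B a (b w) /\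
      last_exit v w r ((pos v).1 + r * cos a, (pos v).2 + r * sin a).
  move=> w.
  case: (boolP (adj v w)) => [vw|_]; last by exists 0.
  have : forall w, adj v w -> exists2 a, annulus_arc v w r B a (b w) &
      last_exit v w r ((pos v).1 + r * cos a, (pos v).2 + r * sin a).
    near: r; apply: (@near_forall _ G (fun w r => adj v w ->
        exists2 a, annulus_arc v w r B a (b w) &
      last_exit v w r ((pos v).1 + r * cos a, (pos v).2 + r * sin a))) => u;
          case: (boolP (adj v u)) => [vu|_]; last exact: nearW.
    by have [_ _] := bP u vu; apply: filterS.
  by move=> /(_ w vw)[x h1 h2]; exists x.
have aord (i j : 'I_(deg v)) : (i < j)%N -> 0 < a (nth v s j) - a (nth v s i) < 2 * pi.
  move=> ij; apply: (annulus_arc_pair (nP i) (nP j) _ (proj1 (aP _ (nP i))) (proj1 (aP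
      _ (nP j))) (bord i j ij)).
  by rewrite nth_uniq ?sz // neq_ltn ij.
exists (fun i => a (nth v s i)); split.
- by move=> i j /aord; lra.
- move=> i j; case: (ltngtP i j) => [/aord|/aord|/val_inj ->]; lra.
- by move=> i; exact: (proj2 (aP _ (nP i))).
Unshelve. all: by end_near.
Qed.

End Listing.

(** * Straightening the edges near the vertices *)

Section Drawing.
Variables (R : realType) (G : plane_graph R) (r : R) (ang : G -> G -> R).
Implicit Types u v w x y : G.
Notation sqd p q := (dot (p - q) (p - q)).

(** Conditions that small r satisfy, with [ang v w] the angle of the last exit. [str_far] makes the
    discs of radius r around the vertices disjoint, and [str_late] puts the last exit from each end
    into the half of the edge nearer to that end, so that the part between the two exits is a
    genuine interval. *)
Record straightened := Straightened {
  str_gt0 : 0 < r;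
  str_exit : forall v w, adj v w ->
    last_exit v w r ((pos v).1 + r * cos (ang v w), (pos v).2 + r * sin (ang v w));
  str_far : forall u v, u != v -> (2 * r) ^+ 2 < sqd (pos u) (pos v);
  str_late : forall u w t, adj u w -> t \in `[1 / 2, 1] ->
      r ^+ 2 < sqd (edge_arc u w t) (pos u);
  str_away : forall u w x t, adj u w -> x != u -> x != w -> t \in `[0, 1] ->
    r ^+ 2 < sqd (edge_arc u w t) (pos x);
  str_ang : forall v w w', adj v w -> adj v w' -> cos (ang v w - ang v w') = 1 -> w = w'
}.

Hypothesis S : straightened.
Let r0 := str_gt0 S.

Lemma r_sq_gt0 : 0 < r ^+ 2. Proof. exact: exprn_gt0. Qed.

Lemma exit_time_ex v w : exists t, adj v w ->
  [/\ t \in `]0, 1 / 2[, edge_arc v w t = pos v + polar r (ang v w) &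
   forall s, s \in `]t, 1] -> r ^+ 2 < sqd (edge_arc v w s) (pos v)].
Proof.
case: (boolP (adj v w)) => [vw|_]; last by exists 0.
have [t [t01 et dt H]] := str_exit S vw; exists t => _.
have et' : edge_arc v w t = pos v + polar r (ang v w).
  by rewrite et [in RHS](surjective_pairing (pos v)).
have nt : sqd (edge_arc v w t) (pos v) = r ^+ 2.
  by rewrite et' addrAC subrr add0r dot_polar.
split => //; last by move=> s /H; rewrite lt_eucl_dist // ltW.
move: t01; rewrite !in_itv /= => /andP[t0 t1]; apply/andP; split.
  rewrite lt_def t0 andbT; apply/eqP => e; move: nt; rewrite e arc_start // subrr.
  by rewrite /dot /= !mul0r addr0; have := r_sq_gt0; lra.
rewrite ltNge; apply/negP => h; have := str_late S vw (t := t); rewrite nt ltxx => H'.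
by suff: false by []; apply: H'; rewrite in_itv /= h.
Qed.

Definition exit_time v w : R := sval (cid (exit_time_ex v w)).

Lemma exit_timeP v w : adj v w ->
  [/\ exit_time v w \in `]0, 1 / 2[,
      edge_arc v w (exit_time v w) = pos v + polar r (ang v w) &
   forall s, s \in `]exit_time v w, 1] -> r ^+ 2 < sqd (edge_arc v w s) (pos v)].
Proof. exact: (svalP (cid (exit_time_ex v w))). Qed.

Definition radial v w (p : R * R) := exists2 rho,
    0 <= rho <= r & p = pos v + polar rho (ang v w).

Definition middle v w (p : R * R) :=
  exists2 s, s \in `[exit_time v w, 1 - exit_time w v] & p = edge_arc v w s.

Definition on_edge v w p := [\/ radial v w p, radial w v p | middle v w p].

Lemma middleC v w p : adj v w -> middle v w p -> middle w v p.
Proof.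
move=> vw [s s1 ->]; exists (1 - s); first by move: s1; rewrite !in_itv /=; lra.
have wv : adj w v by rewrite adjC.
have [h1 _ _] := exit_timeP vw; have [h2 _ _] := exit_timeP wv.
by apply: arc_rev => //; move: s1 h1 h2; rewrite !in_itv /=; lra.
Qed.

Lemma radial_norm v w p : radial v w p -> sqd p (pos v) <= r ^+ 2.
Proof.
move=> [rho /andP[h0 h1] ->]; rewrite addrAC subrr add0r dot_polar.
by rewrite lerXn2r // nnegrE ltW.
Qed.

Lemma discs_disjoint u v p : sqd p (pos u) <= r ^+ 2 -> sqd p (pos v) <= r ^+ 2 ->
    u = v.
Proof.
move=> hu hv; apply/eqP; apply: contraT => /(str_far S).
(* The parallelogram law replaces the triangle inequality, which is awkward for squared
   distances. *)
have : sqd (pos u) (pos v) <= 2 * sqd p (pos u) + 2 * sqd p (pos v).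
  rewrite /dot /=; move: (pos u) (pos v) => a b.
  have := sqr_ge0 (2 * p.1 - a.1 - b.1); have := sqr_ge0 (2 * p.2 - a.2 - b.2).
  rewrite !expr2; lra.
rewrite exprMn; lra.
Qed.

Lemma middle_norm v w p : adj v w -> middle v w p ->
  r ^+ 2 < sqd p (pos v) \/ p = pos v + polar r (ang v w).
Proof.
move=> vw [s s1 ->]; have wv : adj w v by rewrite adjC.
have [h1 h2 h3] := exit_timeP vw; have [h4 _ _] := exit_timeP wv.
move: s1; rewrite in_itv /= => /andP[]; rewrite le_eqVlt => /orP[/eqP <- _|s1 s2];
    first by right.
by left; apply: h3; move: h4; rewrite !in_itv /=; lra.
Qed.

Lemma middle_away v w x p : adj v w -> middle v w p -> x != v -> x != w ->
    r ^+ 2 < sqd p (pos x).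
Proof.
move=> vw [s s1 ->] xv xw; have wv : adj w v by rewrite adjC.
have [h1 _ _] := exit_timeP vw; have [h4 _ _] := exit_timeP wv.
by apply: (str_away S) => //; move: h1 h4 s1; rewrite !in_itv /=; lra.
Qed.

Lemma sqd_polar v a : sqd (pos v + polar r a) (pos v) = r ^+ 2.
Proof. by rewrite addrAC subrr add0r dot_polar. Qed.

(** This is the gain of the straightening: a path inside the disc around v meets an edge only on its
    radius, so avoiding the edge is a matter of angles. *)
Lemma on_edge_disc u w v p : adj u w -> on_edge u w p -> sqd p (pos v) < r ^+ 2 ->
  (v = u /\ radial u w p) \/ (v = w /\ radial w u p).
Proof.
move=> uw [h|h|h] pv.
- by left; split => //; apply: (discs_disjoint (ltW pv)); exact: radial_norm h.
- by right; split => //; apply: (discs_disjoint (ltW pv)); exact: radial_norm h.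
have h' := middleC uw h; have wu : adj w u by rewrite adjC.
have [e|vu] := eqVneq v u.
  by case: (middle_norm uw h) => [h2|e']; move: pv; rewrite e; [move/lt_trans/(_ h2);
      rewrite ltxx|rewrite e' sqd_polar ltxx].
have [e|vw] := eqVneq v w.
  by case: (middle_norm wu h') => [h2|e']; move: pv; rewrite e; [move/lt_trans/(_ h2);
      rewrite ltxx|rewrite e' sqd_polar ltxx].
by have := lt_trans (middle_away uw h vu vw) pv; rewrite ltxx.
Qed.

Lemma polar_eq rho s a b : 0 < rho -> 0 <= s -> polar rho a = polar s b :> R * R ->
    cos (a - b) = 1.
Proof.
move=> h1 h2 e; have := congr1 (fun p => dot p p) e; rewrite !dot_polar => e'.
have s0 : 0 < s by rewrite lt_def h2 andbT; apply/eqP => s0; move: e'; rewrite s0;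
    have := exprn_gt0 2 h1; rewrite expr0n /=; lra.
by apply: (@angle_of_cos1 _ (polar s b)); [exact: angle_of_polar|rewrite -e;
    exact: angle_of_polar].
Qed.

Lemma radial_radial u w x y p : adj u w -> adj x y -> (u, w) != (x, y) ->
  radial u w p -> radial x y p -> exists v, p = pos v.
Proof.
move=> uw xy ne h h'; have e := discs_disjoint (radial_norm h) (radial_norm h').
move: h h'; rewrite -e in xy ne * => -[rho /andP[h0 h1] e1] [s /andP[s0 s1] e2].
move: h0; rewrite le_eqVlt => /orP[/eqP z|h0].
  by exists u; rewrite e1 -z /polar !mul0r addr0.
have /(str_ang S uw xy) e3 : cos (ang u w - ang u y) = 1.
  by apply: polar_eq h0 s0 _; apply: (addrI (pos u)); rewrite -e1.
by move: ne; rewrite e3 eqxx.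
Qed.

Lemma radial_middle u w x y p : adj u w -> adj x y -> (u, w) != (x, y) ->
    (u, w) != (y, x) ->
  radial u w p -> middle x y p -> False.
Proof.
move=> uw xy ne1 ne2 h m; have hn := radial_norm h; have yx : adj y x by rewrite adjC.
have [ux|ux] := eqVneq u x; last first.
  have [uy|uy] := eqVneq u y; last by have := middle_away xy m ux uy; lra.
  case: (middle_norm yx (middleC xy m)) => [|e]; first by rewrite -uy; lra.
  case: h => rho /andP[h0 h1]; rewrite e -uy => /addrI e'.
  have := polar_eq r0 h0 e'; rewrite -uy in yx ne2 * => /(str_ang S yx uw) e3.
  by move: ne2; rewrite e3 eqxx.
case: (middle_norm xy m) => [|e]; first by rewrite -ux; lra.
case: h => rho /andP[h0 h1]; rewrite e -ux => /addrI e'.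
have := polar_eq r0 h0 e'; rewrite -ux in xy ne1 * => /(str_ang S xy uw) e3.
by move: ne1; rewrite e3 eqxx.
Qed.

Lemma middle_time v w p : adj v w -> middle v w p ->
    exists2 s, s \in `]0, 1[ & p = edge_arc v w s.
Proof.
move=> vw [s s1 ->]; exists s => //; have wv : adj w v by rewrite adjC.
by have [h1 _ _] := exit_timeP vw; have [h4 _ _] := exit_timeP wv; move: h1 h4 s1;
    rewrite !in_itv /=; lra.
Qed.

Lemma on_edge_disj u w x y p : adj u w -> adj x y -> (u, w) != (x, y) ->
    (u, w) != (y, x) ->
  on_edge u w p -> on_edge x y p -> exists v, p = pos v.
Proof.
move=> uw xy ne1 ne2.
have wu : adj w u by rewrite adjC. have yx : adj y x by rewrite adjC.
have ne3 : (w, u) != (x, y) by apply: contra_neq ne2 => -[-> ->].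
have ne4 : (w, u) != (y, x) by apply: contra_neq ne1 => -[-> ->].
have sw (a b c d : G) : (a, b) != (c, d) -> (c, d) != (a, b) by rewrite eq_sym.
move=> [h|h|h] [h'|h'|h'].
- exact: radial_radial uw xy ne1 h h'.
- exact: radial_radial uw yx ne2 h h'.
- by case: (radial_middle uw xy ne1 ne2 h h').
- exact: radial_radial wu xy ne3 h h'.
- exact: radial_radial wu yx ne4 h h'.
- by case: (radial_middle wu xy ne3 ne4 h h').
- by case: (radial_middle xy uw (sw _ _ _ _ ne1) (sw _ _ _ _ ne3) h' h).
- by case: (radial_middle yx uw (sw _ _ _ _ ne2) (sw _ _ _ _ ne4) h' h).
have [s s01 e] := middle_time uw h; have [t t01 e'] := middle_time xy h'.
exfalso; move: (arcs_do_not_cross uw xy) => H; apply: (H _ s t) => //;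
    last by rewrite -e -e'.
apply/eqP => /setP E.
have := E u; have := E w; rewrite !inE !eqxx !orbT /= =>
    /esym /orP[/eqP ew|/eqP ew] /esym /orP[/eqP eu|/eqP eu].
- by move: (adj_neq uw); rewrite ew eu eqxx.
- by move: ne2; rewrite ew eu eqxx.
- by move: ne1; rewrite ew eu eqxx.
- by move: (adj_neq uw); rewrite ew eu eqxx.
Qed.

(* From u along a radius, then along the arc, then along a radius to w; each of
   the three summands moves during one third of the time only. *)
Definition mod_edge u w (t : R) : R * R :=
  polar (r * clamp (3 * t)) (ang u w)
  + edge_arc u w (clamp (exit_time u w + (1 - exit_time w u - exit_time u w) * clamp (3
        * t - 1)))
  + (polar (r * (1 - clamp (3 * t - 2))) (ang w u) - polar r (ang w u) - polar r (ang u
        w)).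

Lemma continuous_mod_edge u w : adj u w -> continuous (mod_edge u w).
Proof.
move=> uw.
have ca (a b : R) : continuous (fun t : R => clamp (a * t - b)).
  move=> t; apply: (@continuous_comp _ _ _ (fun t : R => a * t - b) (@clamp R));
      last exact: continuous_clamp.
  by apply: cvgB; [apply: cvgM; [exact: cvg_cst|exact: cvg_id]|exact: cvg_cst].
have cc (c : R) : continuous (fun _ : R => c) by move=> t; exact: cvg_cst.
move=> t; apply: cvgD; first apply: cvgD.
- apply: (continuous_polar (r := fun t =>
      r * clamp (3 * t)) (th := fun=> ang u w)) => // {}t.
  by apply: cvgM; [exact: cvg_cst|have := ca 3 0 t; under eq_fun do rewrite subr0].
- apply: (@continuous_comp _ _ _ (fun t : R =>
      exit_time u w + (1 - exit_time w u - exit_time u w) * clamp (3 * t - 1)) (fun s :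
      R => edge_arc u w (clamp s))).
    by apply: cvgD; [exact: cvg_cst|apply: cvgM; [exact: cvg_cst|exact: ca]].
  exact: (continuous_clamp_comp (arc_continuous uw)).
- apply: cvgB; last exact: cvg_cst; apply: cvgB; last exact: cvg_cst.
  apply: (continuous_polar (r := fun t =>
      r * (1 - clamp (3 * t - 2))) (th := fun=> ang w u)) => // {}t.
  by apply: cvgM; [exact: cvg_cst|apply: cvgB; [exact: cvg_cst|exact: ca]].
Qed.

Lemma clamp_le0 (t : R) : t <= 0 -> clamp t = 0.
Proof. by move=> h; rewrite /clamp min_r ?max_l //; lra. Qed.

Lemma clamp_ge1 (t : R) : 1 <= t -> clamp t = 1.
Proof. by move=> h; rewrite /clamp min_l ?max_r //; lra. Qed.

Lemma arc_exit_end u w : adj u w ->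
    edge_arc u w (1 - exit_time w u) = pos w + polar r (ang w u).
Proof.
move=> uw; have wu : adj w u by rewrite adjC.
have [h1 h2 _] := exit_timeP wu.
rewrite (arc_rev wu) ?subKr //; move: h1; rewrite !in_itv /=; lra.
Qed.

Lemma polar0 a : polar (0 : R) a = 0.
Proof. by rewrite /polar !mul0r. Qed.

Lemma mod_edge_first u w t : adj u w -> 0 <= t <= 1 / 3 ->
    mod_edge u w t = pos u + polar (3 * r * t) (ang u w).
Proof.
move=> uw t13; have wu : adj w u by rewrite adjC.
have [h1 h2 _] := exit_timeP uw.
rewrite /mod_edge (@clamp_le0 (3 * t - 1)); last by lra.
rewrite (@clamp_le0 (3 * t - 2)) ?subr0 ?mulr1 ?mulr0 ?addr0; last by lra.
rewrite (clampE (t := exit_time u w)); last by move: h1; rewrite !in_itv /=; lra.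
rewrite h2 clampE; last by rewrite in_itv /=; lra.
rewrite subrr add0r addrA addrK addrC; congr (_ + polar _ _); ring.
Qed.

Lemma mod_edge_last u w t : adj u w -> 2 / 3 <= t <= 1 ->
    mod_edge u w t = pos w + polar (3 * r * (1 - t)) (ang w u).
Proof.
move=> uw t13; have wu : adj w u by rewrite adjC.
have [h1 h2 _] := exit_timeP wu.
rewrite /mod_edge (@clamp_ge1 (3 * t - 1)); last by lra.
rewrite (@clamp_ge1 (3 * t)) ?mulr1; last by lra.
rewrite (_ : exit_time u w + _ = 1 - exit_time w u); last by ring.
rewrite (clampE (t := 1 - exit_time w u)); last by move: h1; rewrite !in_itv /=; lra.
rewrite arc_exit_end // (clampE (t := 3 * t - 2)); last by rewrite in_itv /=; lra.
rewrite (_ : r * (1 - (3 * t - 2)) = 3 * r * (1 - t)); last by ring.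
move: (polar _ _) (polar r _) (polar r _) (pos w) => a b c d.
by rewrite [a in LHS]lock; case: a b c d => [a1 a2] [b1 b2] [c1 c2] [d1 d2];
    rewrite -lock; congr pair => /=; ring.
Qed.

Lemma mod_edge_middle u w t : adj u w -> 1 / 3 <= t <= 2 / 3 ->
    middle u w (mod_edge u w t).
Proof.
move=> uw t13; have wu : adj w u by rewrite adjC.
have [h1 h2 _] := exit_timeP uw; have [h3 h4 _] := exit_timeP wu.
rewrite /mod_edge (@clamp_ge1 (3 * t)) ?mulr1; last by lra.
rewrite (@clamp_le0 (3 * t - 2)) ?subr0 ?mulr1; last by lra.
rewrite (clampE (t := 3 * t - 1)); last by rewrite in_itv /=; lra.
set s := exit_time u w + _.
have sI : s \in `[exit_time u w, 1 - exit_time w u].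
  move: h1 h3; rewrite /s !in_itv /= => /andP[a1 a2] /andP[a3 a4]; apply/andP; split;
      nra.
exists s => //; rewrite clampE; last by move: sI h1 h3; rewrite !in_itv /=; lra.
by rewrite subrr add0r addrC addrA addNr add0r.
Qed.

Lemma mod_edge0 u w : adj u w -> mod_edge u w 0 = pos u.
Proof. by move=> uw; rewrite mod_edge_first ?mulr0 ?polar0 ?addr0 //; lra. Qed.

Lemma mod_edge1 u w : adj u w -> mod_edge u w 1 = pos w.
Proof. by move=> uw; rewrite mod_edge_last ?subrr ?mulr0 ?polar0 ?addr0 //; lra. Qed.

Lemma mod_edge_on u w t : adj u w -> t \in `[0, 1] -> on_edge u w (mod_edge u w t).
Proof.
move=> uw; rewrite in_itv /= => /andP[t0 t1].
have r0' := r0.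
case: (leP t (1 / 3)) => h1.
  apply: Or31; exists (3 * r * t); last by apply: mod_edge_first => //; lra.
  by apply/andP; split; nra.
case: (leP t (2 / 3)) => h2; first by apply: Or33; apply: mod_edge_middle => //; lra.
apply: Or32; exists (3 * r * (1 - t)); last by apply: mod_edge_last => //; lra.
by apply/andP; split; nra.
Qed.

Lemma mod_edge_not_vertex u w t v : adj u w -> t \in `]0, 1[ -> mod_edge u w t <> pos v.
Proof.
move=> uw; have wu : adj w u by rewrite adjC.
rewrite in_itv /= => /andP[t0 t1].
have H x a rho : 0 < rho <= r -> pos x + polar rho a <> pos v.
  move=> /andP[h0 h1] e.
  have n1 : sqd (pos v) (pos x) <= r ^+ 2.
    by rewrite -e addrAC subrr add0r dot_polar lerXn2r // nnegrE ltW.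
  have n2 : sqd (pos v) (pos v) <= r ^+ 2 by rewrite subrr /dot /= !mul0r addr0 sqr_ge0.
  have ex := discs_disjoint n1 n2; rewrite -ex in e.
  have : sqd (pos x + polar rho a) (pos x) =
      rho ^+ 2 by rewrite addrAC subrr add0r dot_polar.
  by rewrite e subrr /dot /= !mul0r addr0; have := exprn_gt0 2 h0; lra.
have r0' := r0.
case: (leP t (1 / 3)) => h1.
  rewrite mod_edge_first //; last by lra.
  by apply: H; apply/andP; split; nra.
case: (leP t (2 / 3)) => h2; last first.
  rewrite mod_edge_last //; last by lra.
  by apply: H; apply/andP; split; nra.
have t23 : 1 / 3 <= t <= 2 / 3 by lra.
have [s s01 ->] := middle_time uw (mod_edge_middle uw t23).
exact: arc_avoids_vertices.
Qed.

(** Any radius strictly between 0 and r would do; at r / 2 the point is inside the disc where all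
    edges are radii. *)
Definition corner_pt v (a : R) : R * R := pos v + polar (r / 2) a.

Lemma continuous_corner_pt v (a b : R) : continuous (fun s => corner_pt v (a + b * s)).
Proof.
move=> s; apply: cvgD; first exact: cvg_cst.
apply: (continuous_polar (r := fun=> r / 2) (th := fun s => a + b * s)) => [t|];
    first exact: cvg_cst.
exact: continuous_affine.
Qed.

Lemma mod_edge_corner_pt u w t v a : adj u w -> t \in `[0, 1] ->
    mod_edge u w t = corner_pt v a ->
  (v = u /\ cos (a - ang u w) = 1) \/ (v = w /\ cos (a - ang w u) = 1).
Proof.
move=> uw t01 e; have := mod_edge_on uw t01; rewrite e => h.
have r2 : 0 < r / 2 by rewrite divr_gt0.
have nv : sqd (corner_pt v a) (pos v) < r ^+ 2.
  by rewrite /corner_pt addrAC subrr add0r dot_polar ltr_pXn2r ?nnegrE ?ltW //; lra.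
case: (on_edge_disc uw h nv) => -[ev [rho /andP[rho0 _]]];
    rewrite ev => /addrI/(polar_eq r2 rho0) ec.
  by left.
by right.
Qed.

End Drawing.

(** * The index of a circulation *)

Section Circulation.
Variables (R : realType) (G : sgraph).

Record circulation (z : G -> G -> R) := Circulation {
  circ_adj : forall u w, ~~ adj u w -> z u w = 0;
  circ_anti : forall u w, z w u = - z u w;
  circ_div : forall u, \sum_w z u w = 0
}.

End Circulation.

Section WindingNumber.
Variables (R : realType) (G : plane_graph R) (r : R) (ang : G -> G -> R).
Hypothesis S : straightened r ang.
Implicit Types u v w x y : G.
Let r0 := str_gt0 S.
Notation corner_pt := (@corner_pt R G r).

Definition edge_angle_var u w (p : R * R) : R := angle_var (fun t =>
    mod_edge S u w t - p).

(* Each edge is counted in both directions, so that a simple closed curve around p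
   has index 4 pi. *)
Definition windex z p : R := \sum_u \sum_w z u w * edge_angle_var u w p.

Lemma edge_angle_var_move u w (p : R -> R * R) : adj u w -> continuous p ->
  (forall t s, t \in `[0, 1] -> s \in `[0, 1] -> mod_edge S u w t <> p s) ->
  edge_angle_var u w (p 1) - edge_angle_var u w (p 0) =
  angle_var (fun s => pos w - p s) - angle_var (fun s => pos u - p s).
Proof.
move=> uw cp H; have := angle_var_square (continuous_mod_edge (S := S) uw) cp H.
by rewrite mod_edge0 // mod_edge1.
Qed.

Lemma circ_coboundary z (B : G -> R) : circulation z ->
    \sum_u \sum_w z u w * (B w - B u) = 0.
Proof.
move=> cz.
under eq_bigr do under eq_bigr do rewrite mulrBr.
under eq_bigr do rewrite sumrB.
rewrite sumrB exchange_big /= -sumrB big1 // => u _.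
rewrite -!mulr_suml circ_div // mul0r.
have -> : \sum_i z i u = 0.
  by under eq_bigr do rewrite (circ_anti cz); rewrite sumrN circ_div // oppr0.
by rewrite mul0r subrr.
Qed.

(** By [edge_angle_var_move] the term of each edge used by z changes by a difference of one function
    at its two ends, and such differences cancel against a circulation. *)
Lemma index_move z (p : R -> R * R) : circulation z -> continuous p ->
  (forall u w, adj u w -> z u w != 0 -> forall t s, t \in `[0, 1] ->
      s \in `[0, 1] -> mod_edge S u w t <> p s) ->
  windex z (p 1) = windex z (p 0).
Proof.
move=> cz cp H; apply/eqP; rewrite -subr_eq0 /windex -sumrB; apply/eqP.
under eq_bigr do rewrite -sumrB.
rewrite -[RHS](circ_coboundary (fun v => angle_var (fun s => pos v - p s)) cz).
apply: eq_bigr => u _; apply: eq_bigr => w _; rewrite -mulrBr.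
have [->|z0] := eqVneq (z u w) 0; first by rewrite !mul0r.
have uw : adj u w by apply: contraT => /(circ_adj cz) e; rewrite e eqxx in z0.
by rewrite edge_angle_var_move //; exact: H.
Qed.

Lemma index_rotate z v (a b : R) : circulation z ->
  (forall w, adj v w -> z v w != 0 -> forall s, s \in `[0, 1] ->
      cos (a + (b - a) * s - ang v w) != 1) ->
  windex z (corner_pt v b) = windex z (corner_pt v a).
Proof.
move=> cz H.
have := @index_move z (fun s => corner_pt v (a + (b - a) * s)) cz
    (@continuous_corner_pt _ _ _ v a (b - a)).
rewrite mulr1 mulr0 addr0 [a + (b - a)]addrC subrK; apply => u w uw z0 t s t01 s01 e.
case: (mod_edge_corner_pt uw t01 e) => -[ev ec].
  by move: (H w); rewrite ev => /(_ uw z0 s s01); rewrite ec eqxx.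
have wu : adj w u by rewrite adjC.
by move: (H u); rewrite ev (circ_anti cz u w) oppr_eq0 => /(_ wu z0 s s01);
    rewrite ec eqxx.
Qed.

Lemma index_along z u w : circulation z -> adj u w -> z u w = 0 ->
  windex z (corner_pt u (ang u w)) = windex z (corner_pt w (ang w u)).
Proof.
move=> cz uw z0.
(* The modified edge covers each radius in one third of the time, so at 1 / 6 and 5 / 6 it is at
   distance r / 2 from its ends, on the corner points. *)
pose p s := mod_edge S u w (1 / 6 + (4 / 6) * s).
have cp : continuous p.
  move=> s; apply: (@continuous_comp _ _ _ (fun s : R =>
      1 / 6 + (4 / 6) * s) (mod_edge S u w)).
    exact: continuous_affine.
  exact: continuous_mod_edge.
have p0 : p 0 = corner_pt u (ang u w).
  rewrite /p mod_edge_first //; last by lra.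
  by congr (_ + polar _ _); field.
have p1 : p 1 = corner_pt w (ang w u).
  rewrite /p mod_edge_last //; last by lra.
  by congr (_ + polar _ _); field.
rewrite -p0 -p1; apply/esym; apply: index_move => // x y xy zxy t s t01 s01 e.
have ne1 : (u, w) != (x, y) by apply: contra_neq zxy => -[<- <-].
have ne2 : (u, w) != (y, x) by apply: contra_neq zxy => -[<- <-];
    rewrite (circ_anti cz) z0 oppr0.
have sI : 1 / 6 + 4 / 6 * s \in `]0, 1[ by move: s01; rewrite !in_itv /=; lra.
have sI' : 1 / 6 + 4 / 6 * s \in `[0, 1] by move: s01; rewrite !in_itv /=; lra.
have h1 := mod_edge_on S xy t01; have h2 := mod_edge_on S uw sI'.
rewrite e in h1; have [v ev] := on_edge_disj uw xy ne1 ne2 h2 h1.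
exact: (mod_edge_not_vertex (S := S) uw sI ev).
Qed.

Lemma corner_ptD2pi v a : corner_pt v (a + 2 * pi) = corner_pt v a.
Proof.
have := cosD2pin a 1; have := sinD2pin a 1; rewrite !mulr1z !mul1r => e1 e2.
by rewrite /corner_pt /polar e1 e2.
Qed.

Lemma angle_var_center v (a b : R) : angle_var (fun s =>
    pos v - corner_pt v (a + b * s)) = b.
Proof.
rewrite (@angle_varE _ _ (fun s => a - pi + b * s)); first by ring.
split; first exact: continuous_affine.
move=> t _; have -> : pos v - corner_pt v (a + b * t) =
    - polar (r / 2) (a + b * t) by rewrite /corner_pt opprD addrA subrr add0r.
rewrite addrAC; apply: angle_ofN; apply: angle_of_polar; by rewrite divr_gt0.
Qed.

(** From w, which is outside the circle, all corner points at v are seen within a half-plane. The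
    angle is then a function of the point, and a full turn contributes zero. *)
Lemma angle_var_outside v w (a b : R) : v != w ->
  angle_var (fun s => pos w - corner_pt v (a + (b - a) * s)) = - angle_var (fun s =>
      pos w - corner_pt v (b + (a + 2 * pi - b) * s)).
Proof.
move=> vw.
have H (e f : R) : angle_var (fun s => pos w - corner_pt v (e + f * s)) =
    angle_step (pos w - pos v) (pos w - corner_pt v (e + f)) - angle_step (pos w - pos
        v) (pos w - corner_pt v e).
  rewrite (@angle_var_halfplane _ _ (pos w - pos v)).
  - by rewrite mulr1 mulr0 addr0.
  - by move=> s; apply: cvgB; [exact: cvg_cst|exact: continuous_corner_pt].
  move=> t; have -> : pos w - corner_pt v (e + f * t) =
      (pos w - pos v) - polar (r / 2) (e + f * t).
    by rewrite /corner_pt opprD addrA.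
  have d1 : (2 * r) ^+ 2 < dot (pos w - pos v) (pos w - pos v) by apply: (str_far S);
      rewrite eq_sym.
  have d2 : (r / 2) ^+ 2 <= (2 * r) ^+ 2.
    by have r0' := r0; rewrite lerXn2r // ?nnegrE; lra.
  apply: dot_outer; first by rewrite dot_polar; lra.
  by move=> e'; move: d1; rewrite e' dot_polar; lra.
rewrite !H [a + (b - a)]addrC subrK [b + (_ - b)]addrC subrK corner_ptD2pi; ring.
Qed.

(* For the edge vw itself, go from b to a the long way around v: this path misses
   the radius towards w and turns by 2 pi around v together with the short one,
   but by 0 around w. *)
Lemma index_jump z v w (a b c : R) : circulation z -> adj v w ->
  a < c < b -> b < a + 2 * pi -> cos (c - ang v w) = 1 ->
  (forall w', adj v w' -> w' != w -> forall s, s \in `[0, 1] ->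
      cos (a + (b - a) * s - ang v w') != 1) ->
  windex z (corner_pt v b) - windex z (corner_pt v a) = 4 * pi * z v w.
Proof.
move=> cz vw /andP[ac cb] ba ec H.
have wv : adj w v by rewrite adjC.
have vnw := adj_neq vw.
pose B x := angle_var (fun s => pos x - corner_pt v (a + (b - a) * s)).
have short x y : adj x y -> (x, y) != (v, w) -> (x, y) != (w, v) ->
    edge_angle_var x y (corner_pt v b) - edge_angle_var x y (corner_pt v a) = B y - B x.
  move=> xy ne1 ne2.
  have := @edge_angle_var_move x y (fun s =>
      corner_pt v (a + (b - a) * s)) xy (@continuous_corner_pt _ _ _ v a (b - a)).
  rewrite mulr1 mulr0 addr0 [a + (b - a)]addrC subrK; apply => t s t01 s01 e.
  case: (mod_edge_corner_pt xy t01 e) => -[ev ec'].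
    have yw : y != w by apply: contra_neq ne1 => ->; rewrite ev.
    by rewrite -ev in xy ec'; move: (H y xy yw s s01); rewrite ec' eqxx.
  have yx : adj y x by rewrite adjC.
  have xw : x != w by apply: contra_neq ne2 => ->; rewrite ev.
  by rewrite -ev in yx ec'; move: (H x yx xw s s01); rewrite ec' eqxx.
have long x y : adj x y -> (x, y) = (v, w) \/ (x, y) = (w, v) ->
    edge_angle_var x y (corner_pt v a) - edge_angle_var x y (corner_pt v b) =
    angle_var (fun s => pos y - corner_pt v (b + (a + 2 * pi - b) * s)) -
    angle_var (fun s => pos x - corner_pt v (b + (a + 2 * pi - b) * s)).
  move=> xy exy.
  have := @edge_angle_var_move x y (fun s =>
      corner_pt v (b + (a + 2 * pi - b) * s)) xy (@continuous_corner_pt _ _ _ v b (a +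
      2 * pi - b)).
  rewrite mulr1 mulr0 addr0 [b + _]addrC subrK corner_ptD2pi; apply => t s t01 s01 e.
  have [m em] := cos_eq1_int ec.
  have N : cos (b + (a + 2 * pi - b) * s - ang v w) != 1.
    apply/eqP => e1.
    have : b + (a + 2 * pi - b) * s - c = 0.
      apply: cos_eq1_2pi; last by move: s01; rewrite in_itv /= => /andP[s0 s1];
          apply/andP; split; nra.
      by rewrite -[RHS]e1 -[RHS](cosD2pin _ (- m)) mulrNz mulNr -em; congr cos; ring.
    by move: s01; rewrite in_itv /= => /andP[s0 s1]; nra.
  case: (mod_edge_corner_pt xy t01 e) => -[ev ec'].
    case: exy => -[ex ey]; last by move: vnw; rewrite ev ex eqxx.
    by move: N; rewrite -ex -ey ec' eqxx.
  case: exy => -[ex ey]; first by move: vnw; rewrite ev ey eqxx.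
  by move: N; rewrite -ex -ey ec' eqxx.
have cl : angle_var (fun s => pos v - corner_pt v (b + (a + 2 * pi - b) * s)) =
    2 * pi - B v.
  by rewrite /B !angle_var_center; ring.
have wl : angle_var (fun s => pos w - corner_pt v (b + (a + 2 * pi - b) * s)) = - B w.
  by rewrite /B (@angle_var_outside v w a b) // opprK.
have e1 := long v w vw (or_introl erefl); have e2 := long w v wv (or_intror erefl).
rewrite wl cl in e1 e2.
rewrite /windex -sumrB; under eq_bigr do rewrite -sumrB.
(* Subtracting the coboundary of [B], which sums to zero against z, cancels every pair except (v, w)
   and (w, v); each of these leaves 2 pi z v w. *)
rewrite -[RHS]add0r -[X in _ = X + _](circ_coboundary B cz).
apply/eqP; rewrite [X in _ == X]addrC -subr_eq -sumrB; apply/eqP.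
under eq_bigr do rewrite -sumrB.
rewrite pair_big /= (bigD1 (v, w)) //= (bigD1 (w, v)) /=;
    last by apply: contra_neq vnw => -[].
rewrite big1 => [|[x y] /= /andP[ne1 ne2]]; last first.
  case: (boolP (adj x y)) => xy; last by rewrite (circ_adj cz) // !mul0r subrr subr0.
  by rewrite -mulrBr -mulrBr short ?subrr ?mulr0.
rewrite addr0 (circ_anti cz v w).
have -> : edge_angle_var v w (corner_pt v b) =
    edge_angle_var v w (corner_pt v a) - (- B w - (2 * pi - B v)) by rewrite -e1; ring.
have -> : edge_angle_var w v (corner_pt v b) =
    edge_angle_var w v (corner_pt v a) - (2 * pi - B v - - B w) by rewrite -e2; ring.
ring.
Qed.

End WindingNumber.

(** * Corners *)

Section Corners.
Variables (R : realType) (G : plane_graph R).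
Implicit Types u v w x y : G.
Local Notation pi := (@pi R).

Definition listing v : 'I_(deg v) -> G := sval (cid (ccw_listing_exists v)).

Lemma listingP v : [/\ injective (listing (v := v)),
  [set listing i | i : 'I_(deg v)]%SET =
      neighbors v & counterclockwise v (listing (v := v))].
Proof. exact: (svalP (cid (ccw_listing_exists v))). Qed.

Lemma listing_adj v i : adj v (listing (v := v) i).
Proof.
have [_ e _] := listingP v; have : listing i \in neighbors v by rewrite -e imset_f.
by rewrite inE.
Qed.

Variant listing_spec v : G -> Type :=
    ListingSpec (i : 'I_(deg v)) : listing_spec v (listing i).

Lemma listing_onto v w : adj v w -> listing_spec v w.
Proof.
move=> vw; have [_ e _] := listingP v.
have /imsetP/cid2[i _ ->] : w \in [set listing i | i : 'I_(deg v)]%SET by rewrite e inE.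
by constructor.
Qed.

Definition by_listing (T : Type) v (f : 'I_(deg v) -> T) (d : T) w : T :=
  if [pick i | listing (v := v) i == w] is Some i then f i else d.

Lemma by_listingE (T : Type) v (f : 'I_(deg v) ->
    T) d i : by_listing f d (listing i) = f i.
Proof.
rewrite /by_listing; case: pickP => [j /eqP e|/(_ i)]; last by rewrite eqxx.
by have [/(_ _ _ e) -> _ _] := listingP v.
Qed.

Definition ccw_next v w : G := by_listing (fun i : 'I_(deg v) => listing (ordS i)) w w.

Lemma ccw_nextE v i : ccw_next v (listing (v := v) i) = listing (ordS i).
Proof. exact: by_listingE. Qed.

Lemma ccw_next_adj v w : adj v w -> adj v (ccw_next v w).
Proof. by move=> /listing_onto[i]; rewrite ccw_nextE; exact: listing_adj. Qed.

Lemma ccw_next_inj v w w' : adj v w -> adj v w' -> ccw_next v w = ccw_next v w' ->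
    w = w'.
Proof.
move=> /listing_onto[i] /listing_onto[j]; rewrite !ccw_nextE.
by have [inj _ _] := listingP v => /inj /ordS_inj ->.
Qed.

Lemma cos_shift (p q x : R) : cos (p - q) = 1 -> cos (x - p) = cos (x - q).
Proof.
move=> /cos_eq1_int[m e]; rewrite -[RHS](cosD2pin _ (- m)); congr cos.
by rewrite mulrNz mulNr -e; ring.
Qed.

Lemma polar_shift (s p q : R) : cos (p - q) = 1 -> polar s p = polar s q.
Proof.
move=> /cos_eq1_int[m e]; rewrite /polar (_ : p =
    q + m%:~R * (2 * pi)) ?cosD2pin ?sinD2pin //.
by rewrite -e; ring.
Qed.

(** The angle of the edge that follows vw, taken in the turn that starts at [ang v w], so that the
    corner after vw is the open interval from [ang v w] to [na v w]. *)
Definition gap_angles (ang na : G -> G -> R) := forall v w, adj v w ->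
  [/\ ang v w < na v w < ang v w + 2 * pi, cos (na v w - ang v (ccw_next v w)) = 1 &
   forall w' a, adj v w' -> ang v w < a < na v w -> cos (a - ang v w') <> 1].

Lemma gap_angles_exist v (th : 'I_(deg v) -> R) : (1 < deg v)%N ->
  (forall i j : 'I_(deg v), (i < j)%N -> th i < th j) ->
  (forall i j, th j < th i + 2 * pi) ->
  exists na : 'I_(deg v) -> R, forall i,
  [/\ th i < na i < th i + 2 * pi, cos (na i - th (ordS i)) = 1 &
   forall j a, th i < a < na i -> cos (a - th j) <> 1].
Proof.
move=> k1 th_lt th_2pi.
have th_le (i j : 'I_(deg v)) : (i <= j)%N -> th i <= th j.
  by rewrite leq_eqVlt => /orP[/eqP/val_inj->//|/th_lt/ltW].
exists (fun i : 'I_(deg v) => if (i.+1 < deg v)%N then th (ordS i) else th (ordS i) + 2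
    * pi) => i.
have p0 := @pi_gt0 R.
case: ltnP => hi.
  have vi : ordS i = i.+1 :> nat by rewrite /= modn_small.
  split; [|by rewrite subrr cos0|].
    by rewrite th_2pi andbT; apply: th_lt; rewrite vi.
  move=> j a /andP[h1 h2] e; have e0 : a - th j = 0.
    by apply: cos_eq1_2pi => //; have := th_2pi j (ordS i); have := th_2pi i j; lra.
  have ij : (i < j)%N by rewrite ltnNge; apply/negP => /th_le; lra.
  have : (j < i.+1)%N by rewrite -vi ltnNge; apply/negP => /th_le; lra.
  by rewrite ltnS leqNgt ij.
have ei : i.+1 = deg v by apply/eqP; rewrite eqn_leq hi ltn_ord.
have vi : ordS i = 0%N :> nat by rewrite /= ei modnn.
have i0 : (0 < i)%N by rewrite -ltnS ei.
split.
- by rewrite th_2pi /= ltrD2r; apply: th_lt; rewrite vi.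
- rewrite addrAC subrr add0r -[RHS](@cos0 R); have := @cosD2pin R 0 1.
  by rewrite add0r mulr1z mul1r.
move=> j a /andP[h1 h2] e.
have t1 : th (ordS i) <= th j by apply: th_le; rewrite vi.
have t2 : th j <= th i by apply: th_le; rewrite -ltnS ei.
have e0 : a - th j = 0 by apply: cos_eq1_2pi => //; lra.
by lra.
Qed.

(** There are finitely many conditions and each holds for all small r, being implied by a bound on r
    by a positive minimal distance or part of the definition of a counterclockwise listing. *)
Lemma straightened_exists : (forall v, (1 < deg v)%N) ->
  exists r ang na, @straightened R G r ang /\ gap_angles ang na.
Proof.
move=> dg.
have H1 : \forall r \near (0 : R)^'+, forall v, exists theta : 'I_(deg v) -> R,
    [/\ forall i j : 'I_(deg v), (i < j)%N -> theta i < theta j,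
        forall i j : 'I_(deg v), theta j < theta i + 2 * pi &
        forall i : 'I_(deg v), last_exit v (listing i) r
          ((pos v).1 + r * cos (theta i), (pos v).2 + r * sin (theta i))].
  apply: (@near_forall _ G (fun v r => exists theta : 'I_(deg v) -> R,
    [/\ forall i j : 'I_(deg v), (i < j)%N -> theta i < theta j,
        forall i j : 'I_(deg v), theta j < theta i + 2 * pi &
        forall i : 'I_(deg v), last_exit v (listing i) r
          ((pos v).1 + r * cos (theta i), (pos v).2 + r * sin (theta i))])) => v.
  by have [_ _] := listingP v.
have small (c d : R) : 0 < c -> 0 < d -> \forall r \near (0 : R)^'+, (d * r) ^+ 2 < c.
  move=> c0 d0; near=> r.
  have r0 : 0 < r by near: r; exact: nbhs_right_gt.
  have : r < Num.sqrt c / d by near: r; apply: nbhs_right_lt;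
      rewrite divr_gt0 // sqrtr_gt0.
  rewrite ltr_pdivlMr // mulrC => h.
  by rewrite -(sqr_sqrtr (ltW c0)) ltr_pXn2r // ?nnegrE ?sqrtr_ge0 // ltW // mulr_gt0.
have H2 : \forall r \near (0 : R)^'+, forall u v, u != v ->
    (2 * r) ^+ 2 < dot (pos u - pos v) (pos u - pos v).
  apply: (@near_forall _ G (fun u r => forall v, u != v ->
      (2 * r) ^+ 2 < dot (pos u - pos v) (pos u - pos v))) => u.
  apply: (@near_forall _ G (fun v r => u != v ->
      (2 * r) ^+ 2 < dot (pos u - pos v) (pos u - pos v))) => v.
  case: (eqVneq u v) => [_|uv]; first exact: nearW.
  have d0 : 0 < dot (pos u - pos v) (pos u - pos v).
    by apply: dot_gt0 => /eqP; rewrite subr_eq0 => /eqP /pos_inj e;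
        rewrite e eqxx in uv.
  by apply: filterS (small _ 2 d0 _).
have H3 : \forall r \near (0 : R)^'+, forall u w t, adj u w -> t \in `[1 / 2, 1] ->
    r ^+ 2 < dot (edge_arc u w t - pos u) (edge_arc u w t - pos u).
  apply: (@near_forall _ G (fun u r => forall w t, adj u w -> t \in `[1 / 2, 1] ->
    r ^+ 2 < dot (edge_arc u w t - pos u) (edge_arc u w t - pos u))) => u.
  apply: (@near_forall _ G (fun w r => forall t, adj u w -> t \in `[1 / 2, 1] ->
    r ^+ 2 < dot (edge_arc u w t - pos u) (edge_arc u w t - pos u))) => w.
  case: (boolP (adj u w)) => [uw|_]; last exact: nearW.
  have [||m m1 mmin] := @EVT_min R (fun t =>
      dot (rel_arc u w t) (rel_arc u w t)) (1 / 2) 1; first by lra.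
    by apply: continuous_subspaceT; apply: continuous_dot; exact: continuous_rel_arc.
  have m0 : 0 < dot (rel_arc u w m) (rel_arc u w m).
    by apply: dot_gt0; apply: rel_arc_neq0 => //; move: m1; rewrite !in_itv /=; lra.
  apply: filterS (small _ 1 m0 ltr01) => r; rewrite mul1r => hr t _ t1.
  apply: (lt_le_trans hr); have := mmin t t1; rewrite {3 4}/rel_arc [clamp t]clampE //.
  by move: t1; rewrite !in_itv /=; lra.
have H4 : \forall r \near (0 : R)^'+, forall u w x t, adj u w -> x != u -> x != w ->
    t \in `[0, 1] ->
    r ^+ 2 < dot (edge_arc u w t - pos x) (edge_arc u w t - pos x).
  apply: (@near_forall _ G (fun u r => forall w x t, adj u w -> x != u -> x != w ->
      t \in `[0, 1] ->
    r ^+ 2 < dot (edge_arc u w t - pos x) (edge_arc u w t - pos x))) => u.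
  apply: (@near_forall _ G (fun w r => forall x t, adj u w -> x != u -> x != w ->
      t \in `[0, 1] ->
    r ^+ 2 < dot (edge_arc u w t - pos x) (edge_arc u w t - pos x))) => w.
  apply: (@near_forall _ G (fun x r => forall t, adj u w -> x != u -> x != w ->
      t \in `[0, 1] ->
    r ^+ 2 < dot (edge_arc u w t - pos x) (edge_arc u w t - pos x))) => x.
  case: (boolP [&& adj u w, x != u & x != w]) => [/and3P[uw xu xw]|h]; last first.
    by apply: nearW => r t h1 h2 h3; rewrite h1 h2 h3 in h.
  pose g t := edge_arc u w (clamp t) - pos x.
  have [||m m1 mmin] := @EVT_min R (fun t => dot (g t) (g t)) 0 1; first exact: ler01.
    apply: continuous_subspaceT; apply: continuous_dot => t; apply: cvgB;
        last exact: cvg_cst.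
    exact: (continuous_clamp_comp (arc_continuous uw)).
  have m0 : 0 < dot (g m) (g m).
    apply: dot_gt0 => /eqP; rewrite subr_eq0 clampE // => /eqP.
    move: m1; rewrite in_itv /= => /andP[]; rewrite le_eqVlt => /orP[/eqP <- _|m2].
      by rewrite arc_start // => /pos_inj e; rewrite e eqxx in xu.
    rewrite le_eqVlt => /orP[/eqP ->|m3].
      by rewrite arc_end // => /pos_inj e; rewrite e eqxx in xw.
    by apply: arc_avoids_vertices => //; rewrite in_itv /= m2.
  apply: filterS (small _ 1 m0 ltr01) => r; rewrite mul1r => hr t _ _ _ t1.
  by apply: (lt_le_trans hr); have := mmin t t1; rewrite /g [clamp t]clampE.
have [r [r0 [h1 [h2 [h3 h4]]]]] :=
    filter_ex (filterI (nbhs_right_gt (0 : R)) (filterI H1 (filterI H2 (filterI H3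
    H4)))).
pose th v := sval (cid (h1 v)).
have thP v : [/\ forall i j : 'I_(deg v), (i < j)%N -> th v i < th v j,
        forall i j : 'I_(deg v), th v j < th v i + 2 * pi &
        forall i : 'I_(deg v), last_exit v (listing i) r
          ((pos v).1 + r * cos (th v i), (pos v).2 + r * sin (th v i))] by exact:
              (svalP (cid (h1 v))).
have naP v : exists na : 'I_(deg v) -> R, forall i,
  [/\ th v i < na i < th v i + 2 * pi, cos (na i - th v (ordS i)) = 1 &
   forall j a, th v i < a < na i -> cos (a - th v j) <> 1].
  by have [t1 t2 _] := thP v; exact: gap_angles_exist.
exists r, (fun v w => by_listing (th v) 0 w), (fun v w =>
    by_listing (sval (cid (naP v))) 0 w).
split.
  split => //.
  - by move=> v w /listing_onto[i]; rewrite by_listingE; have [_ _] := thP v.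
  - move=> v w w' /listing_onto[i] /listing_onto[j]; rewrite !by_listingE => e.
    have [t1 t2 _] := thP v.
    have e0 : th v i - th v j = 0 by apply: cos_eq1_2pi => //; have := t2 i j;
        have := t2 j i; lra.
    by case: (ltngtP i j) => [/t1 h|/t1 h|/val_inj ->//]; exfalso; lra.
move=> v w /listing_onto[i]; rewrite !ccw_nextE !by_listingE.
have [n1 n2 n3] := svalP (cid (naP v)) i.
by split=> // w' a /listing_onto[j]; rewrite by_listingE; exact: n3.
Unshelve. all: by end_near.
Qed.

(** All that the combinatorial part needs to know about the drawing. [N z v w] is the index,
    normalized by 4 pi, in the corner at v that follows w counterclockwise; in the last clause both
    corners lie to the left of the edge from u to w. *)
Lemma index_system_exists : (forall v, (1 < deg v)%N) ->
  exists N : (G -> G -> R) -> G -> G -> R,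
  [/\ forall (c : R) z z' v w, N (fun x y =>
      c * z x y + z' x y) v w = c * N z v w + N z' v w,
    forall z v w, circulation z -> adj v w ->
        N z v (ccw_next v w) - N z v w = z v (ccw_next v w) &
    forall z u w y, circulation z -> adj u w -> z u w = 0 -> adj w y ->
        ccw_next w y = u ->
      N z u w = N z w y].
Proof.
move=> dg; have [r [ang [na [S gaps]]]] := straightened_exists dg.
have p0 := @pi_gt0 R.
pose mid v w := (ang v w + na v w) / 2.
exists (fun z v w => windex S z (corner_pt r v (mid v w)) / (4 * pi)).
split.
- move=> c z z' v w; rewrite mulrA -mulrDl; congr (_ / _).
  rewrite /windex mulr_sumr -big_split; apply: eq_bigr => x _.
  rewrite mulr_sumr -big_split; apply: eq_bigr => y _ /=; ring.
- move=> z v w cz vw; rewrite -mulrBl.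
  have [/andP[a1 a2] a3 a4] := gaps v w vw.
  have vy := ccw_next_adj vw; set y := ccw_next v w in a3 vy *.
  have [/andP[b1 b2] b3 b4] := gaps v y vy.
  have [m em] := cos_eq1_int a3.
  (* Both [ang v y] and [na v w] are angles of the edge vy; M is the number of whole turns between
     them, and [mid v y + M] lies in the corner directly after the one of [mid v w]. *)
  pose M := m%:~R * (2 * pi); rewrite -/M in em.
  have -> : corner_pt r v (mid v y) = corner_pt r v (mid v y + M).
    by rewrite /corner_pt (@polar_shift _ _ (mid v y)) // addrC addKr;
        have := @cosD2pin R 0 m; rewrite add0r cos0.
  rewrite (@index_jump _ _ _ _ S z v y _ _ (na v w)) //;
      first by rewrite mulrAC divff ?mul1r // gt_eqF // mulr_gt0.
  + by rewrite /mid; lra.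
  + by rewrite /mid; lra.
  move=> w' vw' w'y s; rewrite in_itv /= => /andP[s0 s1]; apply/eqP.
  set a := mid v w; set b := mid v y + M; set phi := a + (b - a) * s.
  have ab : a < b by rewrite /a /b /mid; lra.
  have phi1 : a <= phi by rewrite /phi; nra.
  have phi2 : phi <= b by rewrite /phi; nra.
  case: (ltgtP phi (na v w)) => h.
  + by apply: a4 => //; rewrite h andbT (lt_le_trans _ phi1) // /a /mid; lra.
  + have -> : cos (phi - ang v w') = cos (phi - M - ang v w').
      by rewrite -(cosD2pin _ (- m)) mulrNz mulNr -/M; congr cos; ring.
    apply: b4 => //; apply/andP; split; first by lra.
    by rewrite /b /mid in phi2; lra.
  + rewrite h => e; have := str_ang S vw' vy;
        rewrite -(cos_shift (ang v w') a3) -cosN opprB e.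
    by move=> /(_ erefl) e'; rewrite e' eqxx in w'y.
move=> z u w y cz uw z0 wy ey; congr (_ / _).
have wu : adj w u by rewrite adjC.
have zwu : z w u = 0 by rewrite (circ_anti cz u w) z0 oppr0.
have [/andP[a1 a2] a3 a4] := gaps u w uw.
have [/andP[b1 b2] b3 b4] := gaps w y wy; rewrite ey in b3.
(* The corner point is rotated onto the edge, which is no obstacle since z does not use it, carried
   along the edge, and rotated off it on the same side. *)
rewrite (@index_rotate _ _ _ _ S z u (ang u w) (mid u w)) //; last first.
  move=> w' uw' z1 s; rewrite in_itv /= => /andP[s0 s1]; apply/eqP.
  set phi := _ + _ * s.
  have h1 : ang u w <= phi by rewrite /phi /mid; nra.
  have h2 : phi < na u w by rewrite /phi /mid; nra.
  move: h1; rewrite le_eqVlt => /orP[/eqP <-|h1]; last by apply: a4 => //;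
      rewrite h1 h2.
  by move/(str_ang S uw uw') => e; move: z1; rewrite -e z0 eqxx.
rewrite index_along // -(@index_rotate _ _ _ _ S z w (mid w y) (na w y)) //.
  by rewrite /corner_pt (polar_shift _ b3).
move=> w' ww' z1 s; rewrite in_itv /= => /andP[s0 s1]; apply/eqP.
set phi := _ + _ * s.
have h1 : ang w y < phi by rewrite /phi /mid; nra.
have h2 : phi <= na w y by rewrite /phi /mid; nra.
move: h2; rewrite le_eqVlt => /orP[/eqP ->|h2]; last by apply: b4 => //; rewrite h1 h2.
rewrite -cosN opprB (cos_shift _ b3) => e; have := str_ang S ww' wu e => e'.
by move: z1; rewrite e' zwu eqxx.
Qed.

End Corners.

(** * Faces of the rotation system *)

Section Faces.
Variables (R : realType) (G : sgraph) (ccw_next : G -> G -> G).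
Hypothesis ccw_next_adj : forall v w : G, adj v w -> adj v (ccw_next v w).
Hypothesis ccw_next_inj : forall v w w' : G, adj v w -> adj v w' ->
    ccw_next v w = ccw_next v w' -> w = w'.

Definition dart := {x : G * G | adj x.1 x.2}.
Definition mkdart (u w : G) (uw : adj u w) : dart := exist (fun x : G * G =>
    adj x.1 x.2) (u, w) uw.
Definition src (x : dart) : G := (val x).1.
Definition tgt (x : dart) : G := (val x).2.

Lemma dart_adj (x : dart) : adj (src x) (tgt x). Proof. exact: valP x. Qed.

Lemma dart_eq (x y : dart) : src x = src y -> tgt x = tgt y -> x = y.
Proof.
move=> e1 e2; apply: val_inj.
by rewrite [val x]surjective_pairing [val y]surjective_pairing -/(src x) -/(src y)
    -/(tgt x) -/(tgt y) e1 e2.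
Qed.

Lemma adj_symT (u w : G) : adj u w -> adj w u. Proof. by rewrite adj_sym. Qed.

Definition dart_rev (x : dart) : dart := mkdart (adj_symT (dart_adj x)).
Definition turn (x : dart) : dart := mkdart (ccw_next_adj (dart_adj x)).

Lemma dart_revK : involutive dart_rev. Proof. by move=> x; apply: dart_eq. Qed.

Lemma turn_inj : injective turn.
Proof.
move=> x y e; have e1 : src x = src y := congr1 src e.
have e2 : ccw_next (src x) (tgt x) = ccw_next (src y) (tgt y) := congr1 tgt e.
apply: dart_eq => //; rewrite e1 in e2; apply: ccw_next_inj e2; last exact: dart_adj.
by rewrite -e1; exact: dart_adj.
Qed.

Definition turnp : {perm dart} := perm turn_inj.
Definition dart_revp : {perm dart} := perm (can_inj dart_revK).

(* The dart following x on the boundary of the face to the left of x. *)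
Definition face_next : {perm dart} := (dart_revp * turnp^-1)%g.

Lemma face_nextE x : turn (face_next x) = dart_rev x.
Proof. by rewrite /face_next permM -[turn _](permE turn_inj) permKV permE. Qed.

Lemma src_face_next x : src (face_next x) = tgt x.
Proof. by have := congr1 src (face_nextE x). Qed.

Lemma ccw_next_face_next x : ccw_next (tgt x) (tgt (face_next x)) = src x.
Proof.
have e : ccw_next (src (face_next x)) (tgt (face_next x)) = src x :=
    congr1 tgt (face_nextE x).
by rewrite -src_face_next.
Qed.

(** * The index on the darts and its twist along an edge *)

Variable N : (G -> G -> R) -> G -> G -> R.
Hypothesis N_lin : forall (c : R) z z' v w, N (fun x y =>
    c * z x y + z' x y) v w = c * N z v w + N z' v w.
Hypothesis N_jump : forall z v w, circulation z -> adj v w ->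
    N z v (ccw_next v w) - N z v w = z v (ccw_next v w).
Hypothesis N_along : forall z u w y, circulation z -> adj u w -> z u w = 0 ->
    adj w y -> ccw_next w y = u ->
  N z u w = N z w y.

Definition on_dart (z : G -> G -> R) x : R := z (src x) (tgt x).

Lemma N_turn z x : circulation z ->
    on_dart (N z) (turn x) - on_dart (N z) x = on_dart z (turn x).
Proof. by move=> cz; exact: (N_jump (v := src x) (w := tgt x) cz (dart_adj x)). Qed.

Lemma N_face z x : circulation z -> on_dart z x = 0 ->
    on_dart (N z) (face_next x) = on_dart (N z) x.
Proof.
move=> cz zx; rewrite /on_dart src_face_next; apply/esym; apply: N_along => //.
- exact: dart_adj.
- by have := dart_adj (face_next x); rewrite src_face_next.
- exact: ccw_next_face_next.
Qed.

Lemma circulation_lin (c : R) z z' : circulation z -> circulation z' ->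
  circulation (fun x y : G => c * z x y + z' x y).
Proof.
move=> [a1 b1 c1] [a2 b2 c2]; split.
- by move=> u w h; rewrite a1 // a2 // mulr0 addr0.
- by move=> u w; rewrite b1 b2 mulrN opprD.
- by move=> u; rewrite big_split /= -mulr_sumr c1 c2 mulr0 addr0.
Qed.

(* For a circulation z' that uses x, z - c z' does not for a suitable c. *)
Lemma twist_exists x : exists d : R, forall z, circulation z ->
  on_dart (N z) (face_next x) - on_dart (N z) x = d * on_dart z x.
Proof.
have [[z1 [cz1 z10]]|H] := pselect (exists z, circulation z /\ on_dart z x <> 0);
    last first.
  exists 0 => z cz; rewrite mul0r N_face ?subrr //.
  by apply: contrapT => h; apply: H; exists z.
move/eqP: z10 => z10.
exists ((on_dart (N z1) (face_next x) - on_dart (N z1) x) / on_dart z1 x) => z cz.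
set c := - (on_dart z x / on_dart z1 x).
have cw := circulation_lin c cz1 cz.
have := @N_face _ x cw; rewrite /on_dart !N_lin -/(on_dart z1 x) -/(on_dart z x).
rewrite -!/(on_dart (N z1) _) -!/(on_dart (N z) _) => /(_ _) H.
have {}H : c * on_dart (N z1) (face_next x) + on_dart (N z) (face_next x) =
    c * on_dart (N z1) x + on_dart (N z) x by apply: H; rewrite /c; field.
have -> : on_dart (N z) (face_next x) =
    c * on_dart (N z1) x + on_dart (N z) x - c * on_dart (N z1) (face_next x).
  by rewrite -H; ring.
by rewrite /c; field.
Qed.

Definition twist x : R := sval (cid (twist_exists x)).

Lemma twistP x z : circulation z ->
  on_dart (N z) (face_next x) - on_dart (N z) x = twist x * on_dart z x.
Proof. exact: (svalP (cid (twist_exists x))). Qed.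

Lemma on_dart_rv z x : circulation z -> on_dart z (dart_rev x) = - on_dart z x.
Proof. by move=> cz; rewrite /on_dart /= (circ_anti cz). Qed.

Lemma N_rv z x : circulation z ->
    on_dart (N z) (dart_rev x) = on_dart (N z) (face_next x) - on_dart z x.
Proof.
move=> cz; have := N_turn (face_next x) cz; rewrite face_nextE (on_dart_rv x cz).
by move/eqP; rewrite subr_eq addrC => /eqP.
Qed.

Lemma twist_rv z x : circulation z ->
  on_dart (N z) (face_next (dart_rev x)) - on_dart (N z) (dart_rev x) =
      - (twist x * on_dart z x).
Proof.
move=> cz; have := N_rv (dart_rev x) cz; rewrite dart_revK on_dart_rv // => e.
by rewrite N_rv // -twistP // e; ring.
Qed.

(* The mean of N over the two sides of a dart turns the twist into a difference
   along the edge, while z times this mean telescopes around a vertex. *)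
Definition mean z x : R := on_dart (N z) x - on_dart z x / 2.

Lemma mean_rv z x : circulation z ->
    mean z (dart_rev x) - mean z x = twist x * on_dart z x.
Proof. by move=> cz; rewrite /mean N_rv // on_dart_rv // -twistP //; field. Qed.

Lemma sum_mean z : circulation z -> \sum_x on_dart z x * mean z x = 0.
Proof.
move=> cz; rewrite (reindex_inj turn_inj) /=.
(* The flow is the difference of the indices on the two sides and the mean is half their sum, so the
   product is half a difference of squares. *)
have E x : on_dart z (turn x) * mean z (turn x) =
    (on_dart (N z) (turn x) ^+ 2 - on_dart (N z) x ^+ 2) / 2.
  by rewrite /mean -(N_turn x cz); field.
under eq_bigr do rewrite E.
rewrite -mulr_suml sumrB.
by rewrite -[X in X - _](reindex_inj turn_inj (P := xpredT) (F := fun x =>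
    on_dart (N z) x ^+ 2)) subrr mul0r.
Qed.

Definition pos_dart (x : dart) : bool := (enum_rank (src x) < enum_rank (tgt x))%N.

Lemma pos_dart_rv x : pos_dart (dart_rev x) = ~~ pos_dart x.
Proof.
have : src x != tgt x by apply: contraTneq (dart_adj x) => ->; rewrite adj_irrefl.
rewrite -(inj_eq enum_rank_inj) -val_eqE /= /pos_dart -leqNgt.
by rewrite -/(src x) -/(tgt x); case: ltngtP.
Qed.

Lemma sum_darts (f : dart -> R) : \sum_x f x =
    \sum_(x | pos_dart x) (f x + f (dart_rev x)).
Proof.
rewrite (bigID pos_dart) /= big_split /=; congr (_ + _).
rewrite [RHS](reindex_inj (can_inj dart_revK)) /=.
by apply: eq_big => [x|x _]; rewrite ?pos_dart_rv ?dart_revK.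
Qed.

Lemma twist_quadratic z : circulation z ->
    \sum_(x | pos_dart x) twist x * on_dart z x ^+ 2 = 0.
Proof.
move=> cz; have := sum_mean cz; rewrite sum_darts => e; apply/eqP;
    rewrite -oppr_eq0 -sumrN -[X in _ == X]e; apply/eqP.
apply: eq_bigr => x _; rewrite expr2 mulrA -(mean_rv x cz) on_dart_rv //; ring.
Qed.

Lemma twist_bilinear z w : circulation z -> circulation w ->
  \sum_(x | pos_dart x) twist x * on_dart z x * on_dart w x = 0.
Proof.
move=> cz cw; have := twist_quadratic (circulation_lin 1 cz cw).
have e1 := twist_quadratic cz; have e2 := twist_quadratic cw.
have -> : \sum_(x | pos_dart x) twist x * on_dart (fun x y =>
    1 * z x y + w x y) x ^+ 2 =
  \sum_(x | pos_dart x) twist x * on_dart z x ^+ 2 + \sum_(x | pos_dart x) twist x *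
      on_dart w x ^+ 2 +
  2 * \sum_(x | pos_dart x) twist x * on_dart z x * on_dart w x.
  rewrite mulr_sumr -!big_split /=; apply: eq_bigr => x _; rewrite /on_dart; ring.
by rewrite e1 e2 !add0r => /eqP; rewrite mulf_eq0 pnatr_eq0 /= => /eqP.
Qed.

(** * Cycle space, cut space and face boundaries *)

Definition edge := {x : dart | pos_dart x}.
Notation nE := #|{: edge}|.
Notation nV := #|{: G}|.
Notation nF := #|porbits face_next|.
Definition edge_dart (i : 'I_nE) : dart := val (enum_val i : edge).

Lemma ed_pos i : pos_dart (edge_dart i). Proof. exact: (valP (enum_val i : edge)). Qed.

Lemma ed_inj : injective edge_dart.
Proof. by move=> i j /val_inj /enum_val_inj. Qed.

Lemma ed_rv i j : (edge_dart i == dart_rev (edge_dart j)) = false.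
Proof. by apply/eqP => e; have := ed_pos i; rewrite e pos_dart_rv ed_pos. Qed.

Lemma sum_edges (f : dart -> R) : \sum_(x | pos_dart x) f x = \sum_i f (edge_dart i).
Proof.
rewrite (reindex_omap edge_dart (fun x => omap enum_rank (insub x))) /=; last first.
  by move=> x px; rewrite insubT /= /edge_dart enum_rankK.
apply: eq_bigl => i; rewrite ed_pos /=.
by rewrite (insubT _ (ed_pos i)) /=; apply/eqP; congr Some; rewrite /edge_dart;
    apply: (canLR (@enum_valK _)); apply: val_inj.
Qed.

Definition incidence : 'M[R]_(nE, nV) :=
  \matrix_(i, j) ((enum_val j == src (edge_dart i))%:R - (enum_val j == tgt (edge_dart
      i))%:R).

Definition flow (z : 'rV[R]_nE) (u w : G) : R :=
  \sum_i z 0 i * (((u, w) == val (edge_dart i))%:R - ((w, u) == val (edge_dart i))%:R).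

Lemma rv_ed i j : ((tgt (edge_dart i), src (edge_dart i)) == val (edge_dart j)) = false.
Proof. by rewrite -[(_, _)]/(val (dart_rev (edge_dart i))) val_eqE eq_sym ed_rv. Qed.

Lemma flow_ed z i : on_dart (flow z) (edge_dart i) = z 0 i.
Proof.
rewrite /on_dart /flow (bigD1 i) //= -surjective_pairing eqxx.
rewrite big1 => [|j ji]; first by rewrite rv_ed subr0 mulr1 addr0.
have -> : (val (edge_dart i) == val (edge_dart j)) = false.
  by rewrite val_eqE (inj_eq ed_inj) eq_sym (negbTE ji).
by rewrite rv_ed subrr mulr0.
Qed.

Lemma circulation_flow z : z *m incidence = 0 -> circulation (flow z).
Proof.
move=> z0; split.
- move=> u w uw; rewrite /flow big1 // => i _.
  have -> : ((u, w) == val (edge_dart i)) = false.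
    by apply: contraNF uw => /eqP e; have := dart_adj (edge_dart i);
        rewrite /src /tgt -e.
  have -> : ((w, u) == val (edge_dart i)) = false; last by rewrite subrr mulr0.
  by rewrite adj_sym in uw; apply: contraNF uw => /eqP e;
      have := dart_adj (edge_dart i); rewrite /src /tgt -e.
- by move=> u w; rewrite /flow -sumrN; apply: eq_bigr => i _; rewrite -mulrN opprB.
- move=> u; have := congr1 (fun A : 'rV_nV => A 0 (enum_rank u)) z0;
      rewrite !mxE => e; rewrite -[RHS]e.
  rewrite /flow exchange_big /=; apply: eq_bigr => i _; rewrite -mulr_sumr !mxE;
      congr (_ * _).
  rewrite enum_rankK sumrB; congr (_ - _).
    rewrite (bigD1 (tgt (edge_dart i))) //= big1 => [|w wt].
      by rewrite addr0 [val (edge_dart i)]surjective_pairing xpair_eqE eqxx andbT.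
    by rewrite [val (edge_dart i)]surjective_pairing xpair_eqE (negbTE wt) andbF.
  rewrite (bigD1 (src (edge_dart i))) //= big1 => [|w wt].
    by rewrite addr0 [val (edge_dart i)]surjective_pairing xpair_eqE eqxx.
  by rewrite [val (edge_dart i)]surjective_pairing xpair_eqE (negbTE wt).
Qed.

(** The complement of the cycle space contains the cut space and has the same dimension. *)
Lemma kermx_orthogonal (y : 'rV[R]_nE) : y *m (kermx incidence)^T = 0 ->
    (y <= incidence^T)%MS.
Proof.
move=> y0; have sub1 : (y <= kermx (kermx incidence)^T)%MS by apply/sub_kermxP.
have sub2 : (incidence^T <= kermx (kermx incidence)^T)%MS.
  by apply/sub_kermxP; rewrite -trmx_mul mulmx_ker trmx0.
have rk : \rank (kermx (kermx incidence)^T) = \rank incidence^T.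
  by rewrite mxrank_ker !mxrank_tr mxrank_ker subKn // rank_leq_row.
have : (incidence^T == kermx (kermx incidence)^T)%MS by rewrite -(mxrank_leqif_eq sub2)
    rk.
by move/eqmxP => ->.
Qed.

Definition face_set (f : 'I_nF) : {set dart} := enum_val f.

Definition face_mx : 'M[R]_(nF, nE) := \matrix_(f,
    i) ((edge_dart i \in face_set f)%:R - (dart_rev (edge_dart i) \in face_set f)%:R).

(** By [twist_bilinear] the row y of twisted flows is orthogonal to the cycle space, hence a
    potential difference; the potential repairs the index into a function on the faces, whose values
    are the coefficients of z. *)
Lemma flow_boundary (z : 'rV[R]_nE) : z *m incidence = 0 -> (z <= face_mx)%MS.
Proof.
move=> z0; have cz := circulation_flow z0.
pose y : 'rV[R]_nE := \row_i (twist (edge_dart i) * z 0 i).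
have /submxP[k yk] : (y <= incidence^T)%MS.
  apply: kermx_orthogonal; apply/rowP => j; rewrite !mxE.
  have w0 : row j (kermx incidence) *m incidence = 0 by rewrite -row_mul mulmx_ker row0.
  rewrite -[RHS](twist_bilinear cz (circulation_flow w0)) sum_edges;
      apply: eq_bigr => i _.
  by rewrite !flow_ed !mxE.
pose K (v : G) : R := k 0 (enum_rank v).
have twK i : twist (edge_dart i) * z 0 i =
    K (src (edge_dart i)) - K (tgt (edge_dart i)).
  have := congr1 (fun A : 'rV_nE => A 0 i) yk; rewrite !mxE => ->.
  under eq_bigr do rewrite !mxE mulrBr.
  rewrite sumrB; congr (_ - _).
    rewrite (bigD1 (enum_rank (src (edge_dart i)))) //= enum_rankK eqxx mulr1 big1
        ?addr0 // => j ji.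
    rewrite (_ : (_ == _) = false) ?mulr0 //; apply: contraNF ji => /eqP <-.
    by rewrite enum_valK.
  rewrite (bigD1 (enum_rank (tgt (edge_dart i)))) //= enum_rankK eqxx mulr1 big1 ?addr0
      // => j ji.
  rewrite (_ : (_ == _) = false) ?mulr0 //; apply: contraNF ji => /eqP <-.
  by rewrite enum_valK.
(* From x to the next dart of the face the index grows by K (src x) - K (tgt x), and that dart
   starts at tgt x, so adding the potential at the source removes the change. *)
pose n' x := on_dart (N (flow z)) x + K (src x).
have n'_face x : n' (face_next x) = n' x.
  case: (boolP (pos_dart x)) => px.
    have [i ->] : exists i, x = edge_dart i by exists (enum_rank (Sub x px : edge));
        rewrite /edge_dart enum_rankK.
    have := twistP (edge_dart i) cz; rewrite flow_ed twK /n' src_face_next => e.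
    by rewrite -[on_dart _ (face_next _)](subrK (on_dart (N (flow z)) (edge_dart i)))
        e; ring.
  have [i ->] : exists i, x = dart_rev (edge_dart i).
    have px' : pos_dart (dart_rev x) by rewrite pos_dart_rv.
    by exists (enum_rank (Sub (dart_rev x) px' : edge));
        rewrite /edge_dart enum_rankK /= dart_revK.
  have := twist_rv (edge_dart i) cz; rewrite flow_ed twK /n' src_face_next => e.
  rewrite -[on_dart _ (face_next _)](subrK (on_dart (N (flow z)) (dart_rev (edge_dart
      i)))) e /=.
  by rewrite -/(src _) -/(tgt _); ring.
pose g f := if [pick x in face_set f] is Some x then n' x else 0.
have fcE x f : x \in face_set f -> face_set f = porbit face_next x.
  have /imsetP[w _ ->] : face_set f \in porbits face_next by exact: enum_valP.
  by move=> xw; apply/eqP; rewrite eq_porbit_mem porbit_sym.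
have gE x f : x \in face_set f -> g f = n' x.
  move=> xf; rewrite /g; case: pickP => [w|/(_ x)]; last by rewrite xf.
  rewrite (fcE _ _ xf) => /porbitP[m ->].
  by elim: m => [|m IH]; rewrite ?expg0 ?perm1 // expgSr permM n'_face.
have sum_fc x : \sum_f g f * (x \in face_set f)%:R = n' x.
  have px : porbit face_next x \in porbits face_next by exact: imset_f.
  have f0 : face_set (enum_rank_in px (porbit face_next x)) =
      porbit face_next x by rewrite /face_set enum_rankK_in.
  rewrite (bigD1 (enum_rank_in px (porbit face_next x))) //= f0 porbit_id mulr1.
  rewrite (gE x) ?f0 ?porbit_id // big1 ?addr0 // => f ff.
  rewrite (_ : (_ \in _) = false) ?mulr0 //; apply: contraNF ff => /fcE e.
  by apply/eqP; apply: enum_val_inj; exact: (etrans e (esym f0)).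
have n'_rv x : on_dart (flow z) x = n' x - n' (dart_rev x).
  have e : on_dart (N (flow z)) (face_next x) + K (tgt x) =
      n' x by rewrite -n'_face /n' src_face_next.
  by rewrite -e /n' N_rv // (_ : src (dart_rev x) = tgt x) //; ring.
apply/submxP; exists (\row_f g f); apply/rowP => i; rewrite !mxE.
under eq_bigr do rewrite !mxE mulrBr.
by rewrite sumrB !sum_fc -n'_rv flow_ed.
Qed.

Lemma card_dart : #|{: dart}| = (nE).*2.
Proof.
have h : #|[pred x | ~~ pos_dart x]| = #|[pred x | pos_dart x]|.
  rewrite -!sum1_card (reindex_inj (can_inj dart_revK)) /=.
  by apply: eq_bigl => x; rewrite !inE pos_dart_rv negbK.
rewrite -addnn -(cardC [pred x | pos_dart x]).
rewrite card_sig; congr (_ + _)%N.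
by rewrite -h; apply: eq_card => x.
Qed.

(** Constant vectors bound the rank of the incidence matrix by V - 1, so the cycle space has
    dimension at least E - V + 1, and F faces span it. This is one weaker than Euler's formula, as
    the face boundaries are counted without the relation that they sum to zero; it still makes the
    total charge positive. *)
Lemma euler_bound : (0 < nV)%N -> (#|{: dart}| + 2 <= (nV + nF).*2)%N.
Proof.
move=> v0; rewrite card_dart.
have rk1 : (\rank incidence + 1 <= nV)%N.
  have := @mulmx0_rank_max _ _ _ _ incidence (const_mx 1 : 'cV[R]_nV).
  have -> : \rank (const_mx 1 : 'cV[R]_nV) = 1%N.
    apply/eqP; rewrite eqn_leq rank_leq_col lt0n mxrank_eq0;
        apply/eqP => /matrixP /(_ (Ordinal v0) 0).
    by rewrite !mxE => /eqP; rewrite oner_eq0.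
  apply; apply/matrixP => i j; rewrite !mxE.
  under eq_bigr do rewrite !mxE mulr1.
  rewrite sumrB; apply/eqP; rewrite subr_eq0; apply/eqP.
  have E (x : G) : \sum_(j < nV) (enum_val j == x)%:R = 1 :> R.
    rewrite (bigD1 (enum_rank x)) //= enum_rankK eqxx big1 ?addr0 // => k kx.
    by rewrite (_ : (_ == _) = false) //; apply: contraNF kx => /eqP <-;
        rewrite enum_valK.
  by rewrite !E.
have : (\rank (kermx incidence) <= nF)%N.
  apply: leq_trans (rank_leq_row face_mx); apply: mxrankS.
  by apply/row_subP => i; apply: flow_boundary; rewrite -row_mul mulmx_ker row0.
by rewrite mxrank_ker; move: rk1; rewrite -!muln2; lia.
Qed.

End Faces.

(** * Discharging *)

Section Discharging.
Variables (R : realType) (G : sgraph) (ccw_next : G -> G -> G).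
Hypothesis ccw_next_adj : forall v w : G, adj v w -> adj v (ccw_next v w).
Hypothesis ccw_next_inj : forall v w w' : G, adj v w -> adj v w' ->
    ccw_next v w = ccw_next v w' -> w = w'.
Hypothesis ccw_next_neq : forall v w : G, adj v w -> ccw_next v w != w.
Notation face_next := (face_next ccw_next_adj ccw_next_inj).
Notation turn := (turn ccw_next_adj).
Notation flen x := #|porbit face_next x|.
Implicit Types (x y : dart G) (v w : G).

(** A face of length one would be a loop, and one of length two would make [ccw_next] fix a
    neighbor. *)
Lemma flen_ge3 x : (2 < flen x)%N.
Proof.
have it := iter_porbit face_next x.
case e : #|_| it => [|[|[|k]]] //= it.
- by have := porbit_id face_next x; rewrite (cards0_eq e) inE.
- by have := src_face_next ccw_next_adj ccw_next_inj x; rewrite it;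
      have := dart_adj x => /[swap] ->; rewrite adj_irrefl.
have e1 := face_nextE ccw_next_adj ccw_next_inj (face_next x); rewrite it in e1.
have e2 : face_next x = dart_rev x.
  apply: dart_eq; first exact: src_face_next.
  by have := congr1 (@src G) e1.
have e' := face_nextE ccw_next_adj ccw_next_inj x; rewrite e2 in e'.
have e3 : ccw_next (src (dart_rev x)) (tgt (dart_rev x)) = tgt (dart_rev x) :=
    congr1 (@tgt G) e'.
by have := ccw_next_neq (dart_adj (dart_rev x)); rewrite e3 eqxx.
Qed.

Lemma tri_face x : flen x = 3%N -> face_next (face_next x) = dart_rev (turn x).
Proof.
move=> e; have := iter_porbit face_next x; rewrite e /= => it.
have := face_nextE ccw_next_adj ccw_next_inj (face_next (face_next x));
    rewrite it => ->.
by rewrite dart_revK.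
Qed.

(** Triangles translate the rotation at one vertex into that at another: around a triangulated edge
    vw, the neighbors next to w at v are the neighbors next to v at w. *)
Lemma tri_tgt_face x : flen x = 3%N -> tgt (face_next x) = tgt (turn x).
Proof. by move=> /tri_face e; rewrite -(src_face_next ccw_next_adj ccw_next_inj) e. Qed.

Lemma tri_tgt_turn x : flen x = 3%N -> tgt (turn (dart_rev (turn x))) = tgt x.
Proof. by move=> /tri_face <-; rewrite face_nextE; exact: src_face_next. Qed.

Lemma sum_src (f : dart G -> R) : \sum_x f x = \sum_v \sum_(x | src x == v) f x.
Proof. by rewrite (partition_big (@src G) xpredT). Qed.

Lemma card_src v : #|[pred x : dart G | src x == v]| = deg v.
Proof.
rewrite /deg -(card_in_imset (f := @tgt G) (D := [pred x | src x == v])).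
  apply: eq_card => w; rewrite inE; apply/imsetP/idP => [[x /eqP <- ->]|vw];
      first exact: dart_adj.
  by exists (mkdart vw) => //; rewrite inE.
by move=> x y /eqP e1 /eqP e2 e3; apply: dart_eq => //; rewrite e1 e2.
Qed.

Lemma sum_vertices : (forall v, (0 < deg v)%N) ->
  \sum_(x : dart G) (deg (src x))%:R^-1 = #|{: G}|%:R :> R.
Proof.
move=> dg; rewrite sum_src -sum1_card natr_sum; apply: eq_bigr => v _.
rewrite (eq_bigr (fun _ => (deg v)%:R^-1)); last by move=> x /eqP ->.
by rewrite sumr_const card_src -[LHS]mulr_natr mulVf // pnatr_eq0 -lt0n.
Qed.

Lemma sum_faces : \sum_x (flen x)%:R^-1 = #|porbits face_next|%:R :> R.
Proof.
rewrite (partition_big (porbit face_next) (mem (porbits face_next))) /=;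
    last by move=> x _; exact: imset_f.
rewrite -sum1_card natr_sum; apply: eq_bigr => f /imsetP[y _ ->].
rewrite (eq_bigr (fun _ => (flen y)%:R^-1)); last by move=> x /eqP ->.
rewrite sumr_const -[LHS]mulr_natr.
have -> : #|[pred x | porbit face_next x == porbit face_next y]| = flen y.
  by apply: eq_card => x; rewrite inE eq_porbit_mem.
by rewrite mulVf // pnatr_eq0 -lt0n (leq_trans _ (flen_ge3 y)).
Qed.

Hypothesis degs : forall v, [|| deg v == 5, deg v == 6 | 12 <= deg v]%N.
Hypothesis euler : (#|{: dart G}| + 2 <= (#|{: G}| + #|porbits face_next|).*2)%N.
(** What the absence of the three stars provides. In [one_major] the vertices [ccw_next v w] and w4
    are the two neighbors of v beside w. *)
Hypothesis major_nbr : forall v, deg v = 5%N -> exists2 w, adj v w & (12 <= deg w)%N.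
Hypothesis one_major : forall v w w4, deg v = 5%N -> adj v w -> (12 <= deg w)%N ->
  (forall w', adj v w' -> w' != w -> (deg w' <= 6)%N) -> adj v w4 ->
      ccw_next v w4 = w ->
  (deg (ccw_next v w) == 6%N) && (deg w4 == 6%N) \/ (18 <= deg w)%N && ((deg (ccw_next
      v w) == 6%N) || (deg w4 == 6%N)).

Definition share w : R := 1 - 6 / (deg w)%:R.
(** What reaches the 5-vertex at the end of x from the source of x, directly and through the
    vertices of degree 6 just before and just after it in the rotation at the source. *)
Definition gift x : R := (12 <= deg (src x))%N%:R * (deg (tgt x) == 5%N)%:R * share
    (src x) *
  (1 + (deg (tgt (turn x)) == 6%N)%:R / 2 + (deg (tgt ((turnp ccw_next_adj
      ccw_next_inj)^-1%g x)) == 6%N)%:R / 2).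
Definition nontri x : bool := flen x != 3%N.

Lemma share_ge w (d : nat) : (0 < d)%N -> (d <= deg w)%N -> 1 - 6 / d%:R <= share w.
Proof.
move=> d0 dw; rewrite /share lerD2l lerN2 ler_pM2l // lef_pV2 ?posrE ?ltr0n ?ler_nat //.
exact: leq_trans d0 dw.
Qed.

Lemma share_major w : (12 <= deg w)%N -> 1 / 2 <= share w.
Proof. by move=> /share_ge -/(_ isT); lra. Qed.

Lemma gift_ge0 x : 0 <= gift x.
Proof.
rewrite /gift; case: (leqP 12 (deg (src x))) => h; last by rewrite !mul0r.
have := share_major h; rewrite mul1r => s0.
apply: mulr_ge0; last by rewrite !addr_ge0 // divr_ge0.
by apply: mulr_ge0 => //; lra.
Qed.

Lemma gift_le : \sum_x gift x <= \sum_x (12 <= deg (src x))%N%:R * share (src x).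
Proof.
pose a x : R := (deg (tgt x) == 5%N)%:R; pose b x : R := (deg (tgt x) == 6%N)%:R.
pose m x : R := (12 <= deg (src x))%N%:R * share (src x).
pose tv x := (turnp ccw_next_adj ccw_next_inj)^-1%g x.
have src_turn x : src (turn x) = src x by [].
have tvK x : turn (tv x) = x by rewrite -[turn _](permE (@turn_inj _ _ ccw_next_adj
    ccw_next_inj)) permKV.
have tK x : tv (turn x) = x by rewrite -[turn _](permE (@turn_inj _ _ ccw_next_adj
    ccw_next_inj)) /tv permK.
have src_tv x : src (tv x) = src x by rewrite -src_turn tvK.
(* Reindexing by the rotation books each half share with the neighbor of degree 6 that passes it on;
   it has two sides, so it passes on at most the share it got. *)
have e1 : \sum_x m x * a x * b (turn x) = \sum_x m x * a (tv x) * b x.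
  rewrite [RHS](reindex_inj (@turn_inj _ _ ccw_next_adj ccw_next_inj)) /=.
  by apply: eq_bigr => x _; rewrite tK /m src_turn.
have e2 : \sum_x m x * a x * b (tv x) = \sum_x m x * a (turn x) * b x.
  rewrite [LHS](reindex_inj (@turn_inj _ _ ccw_next_adj ccw_next_inj)) /=.
  by apply: eq_bigr => x _; rewrite tK /m src_turn.
have -> : \sum_x gift x = \sum_x m x * a x + (\sum_x m x * a x * b (turn x)) / 2 +
    (\sum_x m x * a x * b (tv x)) / 2.
  rewrite !mulr_suml -!big_split /=; apply: eq_bigr => x _;
      rewrite /gift /m /a /b /tv; ring.
rewrite e1 e2 !mulr_suml -!big_split /=; apply: ler_sum => x _.
have m0 : 0 <= m x.
  rewrite /m; case: (leqP 12 (deg (src x))) => h; last by rewrite mul0r.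
  by rewrite mul1r; have := share_major h; lra.
have bnd (y : dart G) : 0 <= a y <= 1 by rewrite /a; case: eqP => _;
    rewrite ?lexx ler01.
have /andP[a1 a2] := bnd (tv x); have /andP[a3 a4] := bnd (turn x).
rewrite -/(m x) /b /a -/(a (tv x)) -/(a (turn x)); case: eqP => [->|_] /=;
    first by rewrite !mulr0 !mul0r; lra.
by case: eqP => _ /=; nra.
Qed.

Lemma gift_received v : deg v = 5%N ->
  \sum_(x | src x == v) (1 / 5 - (nontri x)%:R / 2) <= \sum_(x | src x == v) gift
      (dart_rev x).
Proof.
move=> d5; have [M vM dM] := major_nbr d5; pose x0 := mkdart vM.
have sM := share_major dM.
have -> : \sum_(x | src x == v) (1 / 5 - (nontri x)%:R / 2) =
    1 - (\sum_(x | src x == v) (nontri x)%:R) / 2 :> R.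
  rewrite sumrB mulr_suml; congr (_ - _).
  by rewrite sumr_const card_src d5 -mulr_natr; field.
have g0 : gift (dart_rev x0) >= share M.
  rewrite /gift /= dM d5 eqxx !mul1r.
  by apply: ler_peMr; [lra|rewrite -addrA lerDl addr_ge0 // divr_ge0].
(* A corner outside the triangles lowers the demand of v to at most 1 / 2, which a single major
   neighbor covers. *)
have [[x /andP[xv nx1]]|all_tri] := pselect (exists x, (src x == v) && nontri x).
  have : 1 <= \sum_(x | src x == v) (nontri x)%:R :> R.
    by rewrite (bigD1 x) //= nx1 lerDl sumr_ge0.
  have : gift (dart_rev x0) <= \sum_(x | src x == v) gift (dart_rev x).
    by rewrite (bigD1 x0) //= lerDl sumr_ge0 // => y _; exact: gift_ge0.
  lra.
have tri x : src x = v -> flen x = 3%N.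
  by move=> xv; apply/eqP; apply: contra_notT all_tri => h; exists x; rewrite xv eqxx.
rewrite big1; last by move=> x /eqP /tri e; rewrite /nontri e eqxx.
rewrite mul0r subr0.
(* Two major neighbors give at least 1 / 2 each. *)
have [[w /and3P[vw wM dw]]|only] := pselect (exists w, [&& adj v w,
    w != M & (12 <= deg w)%N]).
  pose x1 := mkdart vw; have s1 := share_major dw.
  have g1 : gift (dart_rev x1) >= share w.
    rewrite /gift /= dw d5 eqxx !mul1r.
    by apply: ler_peMr; [lra|rewrite -addrA lerDl addr_ge0 // divr_ge0].
  rewrite (bigD1 x0) //= (bigD1 x1) /=; last first.
    by rewrite eqxx /=; apply: contra_neq wM => /(congr1 (@tgt G)).
  have : 0 <= \sum_(x | (src x == v) && (x != x0) && (x != x1)) gift (dart_rev x).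
    by rewrite sumr_ge0 // => y _; exact: gift_ge0.
  lra.
have minor w' : adj v w' -> w' != M -> (deg w' <= 6)%N.
  move=> vw' w'M; have := degs w' => /or3P[/eqP->|/eqP->|h] //.
  by case: only; exists w'; rewrite vw' w'M h.
pose x4 := (turnp ccw_next_adj ccw_next_inj)^-1%g x0.
have tx4 : turn x4 = x0 by rewrite -[turn _](permE (@turn_inj _ _ ccw_next_adj
    ccw_next_inj)) permKV.
have sx4 : src x4 = v by have := congr1 (@src G) tx4.
have vx4 : adj v (tgt x4) by rewrite -sx4; exact: dart_adj.
have nx4 : ccw_next v (tgt x4) = M.
  have e : ccw_next (src x4) (tgt x4) = M := congr1 (@tgt G) tx4.
  by rewrite sx4 in e.
have := one_major d5 vM dM minor vx4 nx4.
have t1 : tgt ((turnp ccw_next_adj ccw_next_inj)^-1%g (dart_rev x0)) = ccw_next v M.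
  have <- : face_next x0 = (turnp ccw_next_adj ccw_next_inj)^-1%g (dart_rev x0).
    apply: (@turn_inj _ _ ccw_next_adj ccw_next_inj); rewrite face_nextE.
    by rewrite -[RHS](permE (@turn_inj _ _ ccw_next_adj ccw_next_inj)) permKV.
  by rewrite tri_tgt_face // tri.
have t4 : tgt (turn (dart_rev x0)) = tgt x4 by have := tri_tgt_turn (tri _ sx4);
    rewrite tx4.
(* With one major neighbor, two vertices of degree 6 beside it double the gift: 1 / 2 * (1 + 1 / 2 +
   1 / 2) = 1. One alone suffices from degree 18 on, where the share is at least 2 / 3: 2 / 3 * (1 +
   1 / 2) = 1. This is the origin of the bound 17. *)
suff H : (1 : R) <= gift (dart_rev x0) -> 1 <= \sum_(x | src x == v) gift (dart_rev x).
  move=> h; apply: H; rewrite /gift t1 t4 /= dM d5 eqxx !mul1r.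
  case: h => [/andP[-> ->]|/andP[d18 /orP[->|->]]].
  - by move: sM; rewrite /=; lra.
  - have := share_ge (w := M) (d := 18) isT d18; case: eqP => _ /=; nra.
  - have := share_ge (w := M) (d := 18) isT d18; case: eqP => _ /=; nra.
move=> h; apply: (le_trans h).
by rewrite (bigD1 x0) //= lerDl sumr_ge0 // => y _; exact: gift_ge0.
Qed.

Lemma discharging : False.
Proof.
have dg v : (0 < deg v)%N by case/or3P: (degs v) => [/eqP->|/eqP->|] //;
    exact: leq_trans.
(* Summed around a vertex, the first two terms give 6 minus its degree: 1 at a 5-vertex and 0 at a
   6-vertex. *)
pose c x : R := 6 / (deg (src x))%:R - 1 - (nontri x)%:R / 2.
have c_gt0 : 0 < \sum_x c x.
  (* The left side is 6 (V + F - E), spread over the darts. A dart of a triangle gets 6 / 3 - 3 = -1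
     from the face and edge terms, any other at most 6 / 4 - 3 = -1 - 1 / 2, whence the 1 / 2 of a
     corner that is not a triangle. *)
  have : 6 * (\sum_(x : dart G) (deg (src x))%:R^-1 + \sum_x (flen x)%:R^-1 - \sum_(x :
      dart G) 1 / 2) <= \sum_x c x.
    rewrite -[X in 6 * (X - _)]big_split -sumrB mulr_sumr /=; apply: ler_sum => x _;
        rewrite /c /nontri.
    have := flen_ge3 x; case: eqP => [->|ne] h3 /=; first by lra.
    have : (flen x)%:R^-1 <= 4^-1 :> R.
      rewrite lef_pV2 ?posrE ?ltr0n ?ler_nat //; last by exact: leq_trans h3.
      by rewrite ltn_neqAle h3 andbT eq_sym; apply/eqP.
    by lra.
  rewrite sum_vertices // sum_faces sumr_const.
  have : (#|{: dart G}| + 2)%:R <= ((#|{: G}| + #|porbits face_next|).*2)%:R :> R by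
      rewrite ler_nat.
  rewrite -muln2 natrM !natrD -[_ *+ #|_|]mulr_natr.
  have -> : #|(fun _ : dart G => true)| = #|{: dart G}| by apply: eq_card.
  by lra.
have : \sum_x c x <= 0; last by lra.
have -> : \sum_x c x = \sum_x (deg (src x) == 5%N)%:R * c x + \sum_x (deg (src x) !=
    5%N)%:R * c x.
  by rewrite -big_split; apply: eq_bigr => x _ /=; case: eqP => _ /=; ring.
have h1 : \sum_x (deg (src x) == 5%N)%:R * c x <= \sum_x gift x.
  rewrite [leRHS](reindex_inj (can_inj (@dart_revK G))) !sum_src; apply: ler_sum => v _.
  case: (eqVneq (deg v) 5) => d5; last first.
    rewrite big1 => [|x /eqP ->]; last by rewrite (negbTE d5) mul0r.
    by rewrite sumr_ge0 // => x _; exact: gift_ge0.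
  apply: le_trans (gift_received d5); apply: ler_sum => x /eqP sx.
  by rewrite /c sx d5 eqxx !mul1r; lra.
have h2 : \sum_x (deg (src x) != 5%N)%:R * c x <= - \sum_x (12 <= deg (src x))%N%:R *
    share (src x).
  rewrite -sumrN; apply: ler_sum => x _; rewrite /c /share.
  have n0 : 0 <= (nontri x)%:R / 2 :> R by rewrite divr_ge0.
  by case/or3P: (degs (src x)) => [/eqP->|/eqP->|h] /=;
      [lra|lra|rewrite h gtn_eqF ?(leq_trans _ h) //= !mul1r; lra].
have := gift_le; lra.
Qed.

End Discharging.

(** * Stars *)

Section Stars.
Variables (R : realType) (G : plane_graph R).
Implicit Types v w : G.

Lemma iter_ordS k (i : 'I_k) m : iter m (@ordS k) i = ((i + m) %% k)%N :> nat.
Proof.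
elim: m => [|m IH]; first by rewrite addn0 modn_small.
by rewrite iterS /= IH addnS -addn1 modnDml addn1.
Qed.

(** The first entry becomes the last with 2 pi added to its angle, so a listing may start at any
    neighbor. *)
Lemma counterclockwise_ordS v k (n : 'I_k -> G) :
  counterclockwise v n -> counterclockwise v (n \o @ordS k).
Proof.
apply: filterS => r [th [th_lt th_2pi th_exit]].
have p0 := @pi_gt0 R.
have last_wrap (i : 'I_k) : (k <= i.+1)%N -> ordS i = 0%N :> nat.
  by move=> h; rewrite /= (_ : i.+1 = k) ?modnn //; apply/eqP;
      rewrite eqn_leq h ltn_ord.
have small (i : 'I_k) : (i.+1 < k)%N -> ordS i = i.+1 :> nat by move=> h;
    rewrite /= modn_small.
exists (fun i : 'I_k => if (i.+1 < k)%N then th (ordS i) else th (ordS i) + 2 * pi);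
    split.
- move=> i j ij; have ik : (i.+1 < k)%N by exact: leq_ltn_trans (ltn_ord j).
  rewrite ik; case: ltnP => jk; last exact: th_2pi.
  by apply: th_lt; rewrite !small.
- move=> i j; case: ltnP => jk; case: ltnP => ik.
  + exact: th_2pi.
  + by have := th_2pi (ordS i) (ordS j); lra.
  + by rewrite ltrD2r; apply: th_lt; rewrite (last_wrap _ jk) (small _ ik).
  + by rewrite ltrD2r (_ : ordS j = ordS i) ?ltrDl ?mulr_gt0 //; apply: val_inj;
        exact: (etrans (last_wrap _ jk) (esym (last_wrap _ ik))).
- move=> i; case: ltnP => _; first exact: th_exit.
  have := cosD2pin (th (ordS i)) 1; have := sinD2pin (th (ordS i)) 1;
      rewrite !mulr1z !mul1r => -> ->.
  exact: th_exit.
Qed.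

Lemma listing_from v w : adj v w -> exists n : 'I_(deg v) -> G,
  [/\ injective n, [set n i | i : 'I_(deg v)]%SET = neighbors v, counterclockwise v n &
   forall i, n i = iter i (ccw_next v) w].
Proof.
case/listing_onto => i0; have [inj im ccw] := listingP v.
have it_nx (j i : 'I_(deg v)) m : iter m (ccw_next v) (listing j) =
    listing (iter m (@ordS _) j).
  by elim: m => //= m ->; rewrite ccw_nextE.
exists (fun i => listing (iter i0 (@ordS _) i)); split.
- move=> i j /inj; elim: (nat_of_ord i0) i j => //= m IH i j /ordS_inj; exact: IH.
- rewrite -im; apply/setP => w'; apply/imsetP/imsetP => -[i _ ->]; first by eexists.
  exists (iter i0 (@ord_pred _) i) => //; congr listing.
  elim: (nat_of_ord i0) i => // m IH i; rewrite iterSr iterS ord_predK.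
  exact: IH.
- elim: (nat_of_ord i0) => [|m IH] //.
  rewrite (_ : (fun i => _) = (fun i => listing (iter m (@ordS _) i)) \o @ordS _);
      last by apply/funext => i; rewrite iterSr.
  exact: counterclockwise_ordS.
- move=> i; rewrite it_nx //; congr listing; apply: val_inj;
      rewrite /= !iter_ordS addnC //.
Qed.

Lemma iter_ccw_next_deg v w : adj v w -> iter (deg v) (ccw_next v) w = w.
Proof.
case/listing_onto => i.
have it_nx m : iter m (ccw_next v) (listing i) = listing (iter m (@ordS _) i).
  by elim: m => //= m ->; rewrite ccw_nextE.
by rewrite it_nx; congr listing; apply: val_inj; rewrite /= iter_ordS modnDr modn_small.
Qed.

Lemma iter_ccw_next_adj v w m : adj v w -> adj v (iter m (ccw_next v) w).
Proof. by move=> vw; elim: m => //= m; exact: ccw_next_adj. Qed.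

Lemma ccw_next_neq v w : (1 < deg v)%N -> adj v w -> ccw_next v w != w.
Proof.
move=> dv; case/listing_onto => i; rewrite ccw_nextE; have [inj _ _] := listingP v.
rewrite (inj_eq inj) -val_eqE /=; case: (ltnP i.+1 (deg v)) => h.
  by rewrite modn_small // gtn_eqF.
have e : i.+1 = deg v by apply/eqP; rewrite eqn_leq h ltn_ord.
by rewrite e modnn eq_sym -lt0n -ltnS e.
Qed.

Lemma listing5 v w : deg v = 5%N -> adj v w -> exists n : 'I_5 -> G,
  [/\ injective n, [set n i | i : 'I_5]%SET = neighbors v, counterclockwise v n &
   forall i, n i = iter i (ccw_next v) w].
Proof. by move=> <-; exact: listing_from. Qed.

Lemma star_ccw v w (kappa : 5.-tuple (option nat)) : deg v = 5%N -> adj v w ->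
  (forall i : 'I_5, bounded_by (deg (iter i (ccw_next v) w)) (tnth kappa i)) ->
      has_star G kappa.
Proof.
move=> d5 vw H; have [n [inj im ccw nE]] := listing5 d5 vw.
by exists v, n; split=> //; [split=> //; left|move=> i; rewrite nE].
Qed.

Lemma star_cw v w (kappa : 5.-tuple (option nat)) : deg v = 5%N -> adj v w ->
  (forall i : 'I_5, bounded_by (deg (iter i (ccw_next v) w)) (tnth kappa (rev_ord i)))
      -> has_star G kappa.
Proof.
move=> d5 vw H; have [n [inj im ccw nE]] := listing5 d5 vw.
exists v, (n \o @rev_ord 5); split=> //; last first.
  by move=> i; rewrite /= nE -{2}(rev_ordK i).
split.
- exact: inj_comp inj (@rev_ord_inj 5).
- rewrite -im; apply/setP => w'; apply/imsetP/imsetP => -[i _ ->]; first by eexists.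
  by exists (rev_ord i); rewrite //= rev_ordK.
right; rewrite (_ : (n \o _) \o _ = n) //.
by apply/funext => i /=; rewrite rev_ordK.
Qed.

End Stars.

Theorem theorem10 (R : realType) (G : plane_graph R)
    (hmin : min_degree_is G 5)
    (hgap : forall v : G, ~~ (7 <= deg v <= 11)%N) :
  [\/ has_star G [tuple Some 5; Some 6; Some 6; Some 5; None],
      has_star G [tuple Some 5; Some 6; Some 6; Some 6; Some 17] |
      has_star G [tuple Some 6; Some 6; Some 6; Some 6; Some 6]]%N.
Proof.
have [dmin [v0 _]] := hmin.
have degs (v : G) : [|| deg v == 5, deg v == 6 | 12 <= deg v]%N.
  by have := hgap v; have := dmin v; lia.
have dgt1 (v : G) : (1 < deg v)%N by exact: leq_trans (dmin v).
apply: contrapT => H.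
have no1 : ~ has_star G [tuple Some 5; Some 6; Some 6; Some 5; None]%N by move=> h;
    apply: H; apply: Or31.
have no2 : ~ has_star G [tuple Some 5; Some 6; Some 6; Some 6; Some 17]%N by move=> h;
    apply: H; apply: Or32.
have no3 : ~ has_star G [tuple Some 6; Some 6; Some 6; Some 6; Some 6]%N by move=> h;
    apply: H; apply: Or33.
clear H.
have [N [Nlin Njump Nalong]] := index_system_exists dgt1.
have nV : (0 < #|{: G}|)%N by apply/card_gt0P; exists v0.
have nxn (v w : G) : adj v w -> ccw_next v w != w by move=> ?; exact: ccw_next_neq.
apply: (discharging R nxn degs
  (euler_bound (@ccw_next_adj R G) (@ccw_next_inj R G) Nlin Njump Nalong nV)).
- move=> v d5; apply: contrapT => H; apply: no3.
  have [w vw] : exists w, adj v w.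
    have : (0 < #|neighbors v|)%N by rewrite -/(deg v) d5.
    by case/card_gt0P => w; rewrite inE; exists w.
  apply: (star_ccw d5 vw) => i.
  have h : (deg (iter i (ccw_next v) w) <= 6)%N.
    have /or3P[/eqP->|/eqP->|h] // := degs (iter i (ccw_next v) w).
    by case: H; exists (iter i (ccw_next v) w) => //; exact: iter_ccw_next_adj.
  by rewrite (tnth_nth None) /=; case: i h => -[|[|[|[|[|]]]]].
move=> v w w4 d5 vw dw minor vw4 nw4.
pose f i := iter i (ccw_next v) w.
have f5 : f 5%N = w by rewrite /f -d5 iter_ccw_next_deg.
have f4 : f 4%N = w4.
  by apply: (@ccw_next_inj _ _ v) => //;
      [exact: iter_ccw_next_adj|rewrite nw4 -[RHS]f5].
have fm i : (0 < i < 5)%N -> (deg (f i) <= 6)%N.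
  move=> i5; apply: minor; first exact: iter_ccw_next_adj.
  have [n [inj _ _ nE]] := listing5 d5 vw.
  have i5' : (i < 5)%N by case/andP: i5.
  have -> : f i = n (Ordinal i5') by rewrite nE.
  have -> : w = n ord0 by rewrite nE.
  by rewrite (inj_eq inj) -val_eqE /= -lt0n; case/andP: i5.
have d56 i : (0 < i < 5)%N -> deg (f i) != 6%N -> deg (f i) = 5%N.
  by move=> /fm h1 h2; have := dmin (f i); lia.
have vw1 : adj v (ccw_next v w) by exact: ccw_next_adj.
rewrite -f4 -[ccw_next v w]/(f 1%N).
(* Both readings, counterclockwise after w and clockwise before w, put w itself into the last entry,
   where the stars have infinity or 17. *)
have s1 (kappa : 5.-tuple (option nat)) : (forall i : 'I_5,
    bounded_by (deg (f i.+1)) (tnth kappa i)) -> has_star G kappa.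
  by move=> H; apply: (star_ccw d5 vw1) => i; rewrite -iterSr; exact: H.
have s2 (kappa : 5.-tuple (option nat)) : (forall i : 'I_5,
    bounded_by (deg (f i)) (tnth kappa (rev_ord i))) -> has_star G kappa.
  by move=> H; apply: (star_cw d5 vw) => i; exact: H.
have not55 : ~ (deg (f 1%N) = 5%N /\ deg (f 4%N) = 5%N).
  move=> [e1 e4]; apply: no1; apply: s1 => -[[|[|[|[|[|//]]]]] hi];
      rewrite (tnth_nth None) //=.
  - by rewrite e1.
  - exact: (fm 2%N).
  - exact: (fm 3%N).
  - by rewrite e4.
(* From 18 on only the star with the entry infinity restricts v, and it forbids two 5-vertices
   beside w. Up to 17, the star with the entry 17, read in both directions, forbids even one. *)
case: (leqP 18 (deg w)) => d18.
  right; rewrite /=.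
  case: (eqVneq (deg (f 1%N)) 6%N) => //= n1;
      case: (eqVneq (deg (f 4%N)) 6%N) => //= n4.
  by case: not55; split; exact: d56.
left; apply/andP; split; apply/negPn/negP => n6; apply: no2.
- apply: s1 => -[[|[|[|[|[|//]]]]] hi]; rewrite (tnth_nth None) //=.
  + by rewrite (d56 1%N).
  + exact: (fm 2%N).
  + exact: (fm 3%N).
  + exact: (fm 4%N).
  + by have : (deg (f 5%N) <= 17)%N by rewrite f5.
- apply: s2 => -[[|[|[|[|[|//]]]]] hi]; rewrite (tnth_nth None) //=.
  + exact: (fm 1%N).
  + exact: (fm 2%N).
  + exact: (fm 3%N).
  + by rewrite (d56 4%N).
Qed.
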